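(* Let $\mathbf{A}\in\mathbb{R}^{n\times m}$ with $m>n$ be a deterministic matrix whose columns $\mathbf{a}_1,\dots,\mathbf{a}_m$ satisfy $\|\mathbf{a}_i\|_2=1$, and let $\mu$ be its mutual coherence. Let $\mathbf{x}_0\in\mathbb{R}^m$ be a deterministic vector with sparsity $\|\mathbf{x}_0\|_0=s$, and let $\mathbf{b}=\mathbf{A}\mathbf{x}_0+\mathbf{w}$, where $\mathbf{w}\sim N(\mathbf{0},\sigma^2\mathbf{I})$ is a random noise vector in $\mathbb{R}^n$, $\sigma>0$. Let $\gamma>0$ be a regularization parameter. Suppose that $$s<\frac{1}{3\mu}.$$ Then, with probability exceeding $$\left(1-(m-s)\exp\left(-\frac{\gamma^2}{8\sigma^2}\right)\right)\left(1-e^{-s/7}\right),$$ the solution $\hat{\mathbf{x}}_{\mathrm{BP}}$ of the problem $$\min_{\mathbf{x}\in\mathbb{R}^m}\ \tfrac12\|\mathbf{b}-\mathbf{A}\mathbf{x}\|_2^2+\gamma\|\mathbf{x}\|_1$$ is unique and satisfies $$\|\mathbf{x}_0-\hat{\mathbf{x}}_{\mathrm{BP}}\|_2^2\le\left(\sigma\sqrt3+\tfrac32\gamma\right)^2 s.$$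
   Context: $\|\mathbf{x}\|_0$ denotes the number of nonzero entries of $\mathbf{x}$. The mutual coherence of a matrix $\mathbf{A}$ with columns $\mathbf{a}_1,\dots,\mathbf{a}_m$ is $\mu=\max_{i\neq j}|\mathbf{a}_i^T\mathbf{a}_j|$. The optimization problem in the claim is called basis pursuit denoising (BPDN). Probability is with respect to the noise $\mathbf{w}$. *)

(* Defs.v *)
(* Library: MathComp-Analysis. *)
From HB Require Import structures.
From mathcomp Require Import all_boot all_order all_algebra.
From mathcomp Require Import all_classical all_reals all_analysis.

Set Implicit Arguments.
Unset Strict Implicit.
Unset Printing Implicit Defensive.

Import Order.TTheory GRing.Theory Num.Theory.
Import numFieldNormedType.Exports.

Local Open Scope classical_set_scope.
Local Open Scope ring_scope.

(* The library's norm [`|v|] on matrices is the sup norm, hence the explicit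
   Euclidean and l1 norms. *)
Definition l2norm (R : realType) (k : nat) (v : 'cV[R]_k) : R :=
  Num.sqrt (\sum_(i < k) v i 0 ^+ 2).

Definition l1norm (R : realType) (k : nat) (v : 'cV[R]_k) : R :=
  \sum_(i < k) `|v i 0|.

Definition l0norm (R : realType) (k : nat) (v : 'cV[R]_k) : nat :=
  #|[set i : 'I_k | v i 0 != 0]%SET|.

(* The entries are nonnegative, so the default value 0 is harmless. *)
Definition coherence (R : realType) (n m : nat) (A : 'M[R]_(n, m)) : R :=
  \big[Num.max/0]_(ij : 'I_m * 'I_m | ij.1 != ij.2)
    `|((col ij.1 A)^T *m col ij.2 A) 0 0|.

Definition bpdn_objective (R : realType) (n m : nat) (A : 'M[R]_(n, m))
    (b : 'cV[R]_n) (gamma : R) (x : 'cV[R]_m) : R :=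
  2^-1 * l2norm (b - A *m x) ^+ 2 + gamma * l1norm x.

Definition bpdn_solution (R : realType) (n m : nat) (A : 'M[R]_(n, m))
    (b : 'cV[R]_n) (gamma : R) (x : 'cV[R]_m) : Prop :=
  forall y : 'cV[R]_m,
    bpdn_objective A b gamma x <= bpdn_objective A b gamma y.

Definition mutually_independent (R : realType) (d : measure_display)
    (T : measurableType d) (P : probability T R) (I : finType)
    (X : I -> {RV P >-> R}) : Prop :=
  forall (J : {set I}) (B : I -> set R), (forall i, measurable (B i)) ->
    P (\bigcap_(i in [set` J]) (X i @^-1` B i)) =
    (\prod_(i in J) P (X i @^-1` B i))%E.

(* The vector (w_1, ..., w_n) has law N(0, sigma^2 I): its components are
   independent, each N(0, sigma^2); [normal_prob] takes the mean and the
   standard deviation. *)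
Definition white_gaussian (R : realType) (d : measure_display)
    (T : measurableType d) (P : probability T R) (n : nat) (sigma : R)
    (w : 'I_n -> {RV P >-> R}) : Prop :=
  (forall (i : 'I_n) (B : set R), measurable B ->
     distribution P (w i) B = normal_prob 0 sigma B) /\
  mutually_independent w.

(* Main.v *)
Require Import Defs.
From HB Require Import structures.
From mathcomp Require Import all_boot all_order all_algebra.
From mathcomp Require Import all_classical all_reals all_analysis.
From mathcomp Require Import measurable_realfun.
From mathcomp Require Import ring lra.

Set Implicit Arguments.
Unset Strict Implicit.
Unset Printing Implicit Defensive.

Import Order.TTheory GRing.Theory Num.Theory.
Import numFieldNormedType.Exports.

Local Open Scope classical_set_scope.
Local Open Scope ring_scope.

(** Let S be the support of x0, of size s, and let mu be the coherence of A. The proof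
splits into a deterministic recovery result and a probability bound, linked by the least
squares fit of the noise.

Deterministic part. The columns in S are nearly orthonormal: row i of the Gram matrix
differs from the identity by entries of size at most mu, and 3 s mu < 1, so the Gram matrix
of S is diagonally dominant ([gram_row], [gram_sup], [gram_sqr]). Write the noise as
w = A u + r, where u is the least squares fit supported by S, so that r is orthogonal to the
columns in S. Let x minimise the objective among the vectors supported by S, and put
z = x0 + u - x. Stationarity on S says that A^T A z is bounded by gamma on S, whence
|z_i| <= 3 gamma / 2. If |<a_i, r>| <= gamma / 2 off S, then the correlation of the residual
b - A x with each column off S is strictly below gamma. This dual certificate makes x the
unique minimiser over all vectors ([dual_certificate]), and x0 - x = z - u is small as soon
as |A u|^2 <= 2 s sigma^2 ([recovery]).

Probability. It remains to bound from below the probability that |A u|^2 <= 2 s sigma^2 and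
|<a_i, r>| <= gamma / 2 for all i off S. White Gaussian noise stays white under a rotation
in a coordinate plane ([white_rotate]), because a plane rotation is a product of three
shears, each of which preserves Lebesgue measure by translation invariance, and the Gaussian
density is radial. Composing such rotations, the columns in S can be made to vanish after
the first s coordinates, so |A u|^2 is at most a sum of s squared independent Gaussians;
Chernoff's bound gives |A u|^2 > 2 s sigma^2 a probability at most (sqrt 2 e^(-1/2))^s
([energy_tail]), which is below e^(-s/7) if s > 0. Rotating instead the component of a_i
orthogonal to the columns in S onto a single axis shows that <a_i, r> is independent of A u
and is a Gaussian of variance at most sigma^2, so that its tail costs a factor
e^(-gamma^2 / (8 sigma^2)) even inside the event on A u ([residual_tail]). A union bound
inside that event yields the product form of the estimate ([recovered_ge]). When the claimed
lower bound is not positive, the strict inequality follows from the fact that very small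
noise has positive probability and leads to recovery ([recovered_gt0]).

Measurability. Uniqueness of the minimiser within a closed ball is equivalent to a
Cauchy-type condition on the approximate minimisers with rational entries, which involves
countably many quantifiers ([unique_solution_rational]). *)

(** * The Gaussian measure on the line *)

(** Lebesgue measure is determined by its values on half-open intervals, whose lengths a
translation does not change. *)
Lemma lebesgue_measure_shift (R : realType) (a : R) (A : set R) :
  measurable A ->
  lebesgue_measure ((fun x : R => x + a) @^-1` A) = lebesgue_measure A :> \bar R.
Proof.
move=> mA.
have mf : measurable_fun [set: measurableTypeR R]
    (fun x : measurableTypeR R => (x + a : measurableTypeR R)).
  exact: measurable_funD.
pose Mf : {mfun measurableTypeR R >-> measurableTypeR R} :=
  HB.pack (fun x : measurableTypeR R => (x + a : measurableTypeR R))
    (isMeasurableFun.Build _ _ _ _ _ mf).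
suff -> : lebesgue_measure A = pushforward (@lebesgue_measure R) Mf A by [].
apply: (@lebesgue_measure_unique _ (pushforward (@lebesgue_measure R) Mf)) => //.
move=> X [[x y] _ <-] /=.
rewrite /pushforward /=.
have -> : (fun z : R => z + a) @^-1` `]x, y] = `](x - a), (y - a)]%classic.
  by apply/seteqP; split => z /=; rewrite !in_itv /= ltrBlDr lerBrDr.
rewrite !lebesgue_measure_itv /= !lte_fin ltrD2r.
by case: ifPn => // _; rewrite -!EFinD; congr EFin; ring.
Qed.

Lemma ge0_integral_shift (R : realType) (a : R) (f : R -> \bar R) :
  measurable_fun setT f -> (forall x, 0 <= f x)%E ->
  (\int[lebesgue_measure]_x f ((x : R) + a)%R = \int[lebesgue_measure]_x f x)%E.
Proof.
move=> mf f0.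
have ms : measurable_fun [set: measurableTypeR R]
    (fun x : measurableTypeR R => (x + a : measurableTypeR R)).
  exact: measurable_funD.
pose Mf : {mfun measurableTypeR R >-> measurableTypeR R} :=
  HB.pack (fun x : measurableTypeR R => (x + a : measurableTypeR R))
    (isMeasurableFun.Build _ _ _ _ _ ms).
transitivity (\int[pushforward (@lebesgue_measure R) Mf]_x f x)%E.
  by rewrite ge0_integral_pushforward.
apply: eq_measure_integral => A mA _.
exact: lebesgue_measure_shift.
Qed.

(** The Gaussian density is a Radon-Nikodym derivative, hence almost everywhere equal to the
one for which the change of variables is known. *)
Lemma ge0_integral_normal (R : realType) (sigma : R) (f : R -> \bar R) :
  measurable_fun setT f -> (forall x, 0 <= f x)%E ->
  (\int[normal_prob 0 sigma]_x f x =
   \int[lebesgue_measure]_x (f x * (normal_pdf 0 sigma x)%:E))%E.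
Proof.
move=> mf f0.
have dom := @normal_prob_dominates R 0 sigma.
rewrite -(Radon_Nikodym_SigmaFinite.change_of_variables dom) //.
have mg := measurable_int _ (Radon_Nikodym_SigmaFinite.f_integrable dom).
have mp : measurable_fun setT (fun x => (normal_pdf (0 : R) sigma x)%:E).
  by apply/measurable_EFinP; exact: measurable_normal_pdf.
apply: ae_eq_integral => //; try exact: emeasurable_funM.
apply: ae_eqe_mul2l.
apply: integral_ae_eq => //.
  exact: Radon_Nikodym_SigmaFinite.f_integrable.
move=> E _ mE; rewrite -Radon_Nikodym_SigmaFinite.f_integral //.
Qed.

(** Shifting the tail to the origin costs the factor e^(- tau^2 / (2 sigma^2)), because
(x + tau)^2 >= x^2 + tau^2 for x > 0. With [s] equal to 1 or -1 this covers both tails;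
adding them up then loses no factor 2, unlike the exponential Markov inequality. *)
Lemma normal_half_tail (R : realType) (sigma tau s : R) :
  sigma != 0 -> 0 <= tau -> s ^+ 2 = 1 ->
  (normal_prob 0 sigma [set x : R | (tau < s * x)%R] <=
   (expR (- (tau ^+ 2 / (2 * sigma ^+ 2))))%:E *
   normal_prob 0 sigma [set x : R | (0 < s * x)%R])%E.
Proof.
move=> sn0 t0 s1; set e := expR _.
have mp : measurable_fun setT (fun x => (normal_pdf 0 sigma x)%:E).
  by apply/measurable_EFinP; exact: measurable_normal_pdf.
have p0 x : (0 <= (normal_pdf 0 sigma x)%:E)%E.
  by rewrite lee_fin normal_pdf_ge0.
have mD r : measurable [set x : R | r < s * x].
  rewrite -[X in measurable X]setTI; exact: measurable_fun_ltr.
have key (x : R) : 0 < s * x ->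
   normal_pdf 0 sigma (x + s * tau) <= e * normal_pdf 0 sigma x.
  move=> xc; rewrite !normal_pdfE // /normal_fun !subr0 mulrCA ler_wpM2l //.
    exact: normal_peak_ge0.
  rewrite -expRD ler_expR !mulNr -opprD lerN2 -[sigma ^+ 2 *+ 2]mulr_natl -mulrDl ler_wpM2r //.
    by rewrite invr_ge0 mulr_ge0 ?sqr_ge0.
  have -> : (x + s * tau) ^+ 2 = x ^+ 2 + 2 * (tau * (s * x)) + s ^+ 2 * tau ^+ 2.
    by ring.
  have := mulr_ge0 t0 (ltW xc); rewrite s1; lra.
rewrite /normal_prob integral_mkcond -(@ge0_integral_shift _ (s * tau)) /=; last 2 first.
- by apply/(measurable_restrictT _ _).1; [exact: mD|exact: measurable_funTS].
- by move=> x; rewrite patchE; case: ifPn.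
rewrite -ge0_integralZl//; last 3 first.
- exact: mD.
- exact: measurable_funTS.
- by rewrite lee_fin expR_ge0.
rewrite [leRHS]integral_mkcond; apply: ge0_le_integral => //.
- by move=> x _; rewrite patchE; case: ifPn.
- apply: (@measurableT_comp _ _ _ _ _ _ (_ \_ [set x : R | tau < s * x])) => //.
    by apply/(measurable_restrictT _ _).1; [exact: mD|exact: measurable_funTS].
  exact: measurable_funD.
- apply/(measurable_restrictT _ _).1; first exact: mD.
  apply: measurable_funTS; exact: measurable_funeM.
move=> x _; rewrite !patchE.
have [/set_mem /=|_] := boolP (_ \in _); last first.
  by case: ifPn => // _; rewrite -EFinM lee_fin mulr_ge0 ?normal_pdf_ge0 ?expR_ge0.
rewrite mulrDr mulrA -expr2 s1 mul1r ltrDr => x0.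
by rewrite mem_set // -EFinM lee_fin key.
Qed.

Lemma normal_tail (R : realType) (sigma tau : R) : 0 < sigma -> 0 <= tau ->
  (normal_prob 0 sigma [set x : R | (tau < `|x|)%R] <=
   (expR (- (tau ^+ 2 / (2 * sigma ^+ 2))))%:E)%E.
Proof.
move=> s0 t0; set e := expR _.
have sn0 : sigma != 0 by rewrite gt_eqF.
have mD (s r : R) : measurable [set x : R | r < s * x].
  rewrite -[X in measurable X]setTI; exact: measurable_fun_ltr.
have -> : [set x : R | (tau < `|x|)%R] =
    [set x : R | tau < 1 * x] `|` [set x : R | tau < - 1 * x].
  by apply/seteqP; split => x /=; rewrite mul1r mulN1r lter_normr => /orP.
apply: (@le_trans _ _ (e%:E * (normal_prob 0 sigma [set x : R | (0 < 1 * x)%R] +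
   normal_prob 0 sigma [set x : R | (0 < -1 * x)%R]))%E).
  have := measureU2 (normal_prob 0 sigma) (mD 1 tau) (mD (- 1) tau).
  move=> /le_trans; apply.
  rewrite ge0_muleDr //; apply: leeD; apply: normal_half_tail => //.
    by rewrite expr1n.
  by rewrite sqrrN expr1n.
have m2 : [set x : R | 0 < 1 * x] `&` [set x : R | 0 < - 1 * x] = set0.
  by apply/seteqP; split => x //=; rewrite mul1r mulN1r oppr_gt0 => -[]; lra.
have := measureU (normal_prob 0 sigma) (mD 1 0) (mD (- 1) 0) m2.
move=> /= <-; rewrite -[leRHS]mule1 lee_pmul // ?lee_fin ?expR_ge0 //.
by apply: (@probability_le1 _ _ _ (normal_prob 0 sigma)); apply: measurableU; exact: mD.
Qed.

(** The exponential moment of the square at half of its critical exponent: multiplied by this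
exponential, the Gaussian density becomes sqrt 2 times the density with sqrt 2 times the
standard deviation. *)
Lemma integral_normal_expR_sqr (R : realType) (sigma : R) : 0 < sigma ->
  (\int[normal_prob 0 sigma]_x (expR ((4 * sigma ^+ 2)^-1 * x ^+ 2))%:E =
   (Num.sqrt 2)%:E)%E.
Proof.
move=> s0; have sn0 : sigma != 0 by rewrite gt_eqF.
have r20 : Num.sqrt 2 != 0 :> R by rewrite gt_eqF// sqrtr_gt0.
have sn20 : Num.sqrt 2 * sigma != 0 by rewrite mulf_neq0.
rewrite ge0_integral_normal; last 2 first.
- apply/measurable_EFinP; apply: measurableT_comp => //.
  apply: measurable_funM => //; exact: measurable_funX.
- by move=> x; rewrite lee_fin expR_ge0.
under eq_integral => x _.
  have -> : ((expR ((4 * sigma ^+ 2)^-1 * x ^+ 2))%:E * (normal_pdf 0 sigma x)%:E =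
     (Num.sqrt 2)%:E * (normal_pdf 0 (Num.sqrt 2 * sigma) x)%:E)%E.
    rewrite -!EFinM !normal_pdfE // /normal_peak /normal_fun !subr0.
    rewrite exprMn sqr_sqrtr //.
    have -> : Num.sqrt (2 * sigma ^+ 2 * pi *+ 2) =
        Num.sqrt 2 * Num.sqrt (sigma ^+ 2 * pi *+ 2) :> R.
      by rewrite -sqrtrM //; congr Num.sqrt; ring.
    rewrite mulrCA -expRD (invfM (Num.sqrt 2)) -(mulrA (Num.sqrt 2)^-1) mulVKf //.
    congr (_ * expR _)%:E.
    by field.
  over.
rewrite ge0_integralZl //; last 2 first.
- by apply/measurable_EFinP; exact: measurable_normal_pdf.
- by move=> x _; rewrite lee_fin normal_pdf_ge0.
by rewrite integral_normal_pdf mule1.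
Qed.

(** * Rotation invariance in the plane *)

Section plane.
Context {R : realType}.
Notation mu := (@lebesgue_measure R).
Implicit Types F : R * R -> \bar R.

Let I F : \bar R := (\int[mu]_x \int[mu]_y F (x, y))%E.

(** A shear is a translation in one variable whose amount is a function of the other, so it
preserves iterated integrals. *)
Lemma integral_shear1 (a : R) F : measurable_fun setT F -> (forall z, 0 <= F z)%E ->
  (I (fun z => F (z.1 + a * z.2, z.2)%R) = I F)%E.
Proof.
move=> mF F0; rewrite /I.
rewrite (@fubini_tonelli _ _ _ _ _ mu mu (fun z : R * R => F (z.1 + a * z.2, z.2)%R)) //=; last first.
  apply: measurableT_comp => //; apply/measurable_fun_pairP; split => /=.
    by apply: measurable_funD => //; exact: measurable_funM.
  exact: measurable_snd.
transitivity (\int[mu]_y \int[mu]_x F (x, y))%E; last first.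
  by symmetry; exact: (@fubini_tonelli _ _ _ _ _ mu mu F).
apply: eq_integral => y _.
by rewrite (@ge0_integral_shift _ (a * y) (fun x : R => F (x, y))) //;
  exact: measurable_fun_pair1.
Qed.

Lemma integral_shear2 (a : R) F : measurable_fun setT F -> (forall z, 0 <= F z)%E ->
  (I (fun z => F (z.1, z.2 + a * z.1)%R) = I F)%E.
Proof.
move=> mF F0; apply: eq_integral => x _ /=.
by rewrite (@ge0_integral_shift _ (a * x) (fun y : R => F (x, y))) //;
  exact: measurable_fun_pair2.
Qed.

(** A rotation of sine s is the composition of the shears of coefficients (1 - c) / s, - s
and (1 - c) / s along the first, second and first axis. *)
Lemma integral_rotation (c s : R) F : s != 0 -> c ^+ 2 + s ^+ 2 = 1 ->
  measurable_fun setT F -> (forall z, 0 <= F z)%E ->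
  (I (fun z => F (c * z.1 + s * z.2, - s * z.1 + c * z.2)%R) = I F)%E.
Proof.
move=> s0 cs mF F0; pose a := (1 - c) / s.
have m1 : measurable_fun setT (fun z : R * R => (z.1 + a * z.2, z.2)%R).
  apply/measurable_fun_pairP; split => /=.
    by apply: measurable_funD => //; exact: measurable_funM.
  exact: measurable_snd.
have m2 : measurable_fun setT (fun z : R * R => (z.1, z.2 + - s * z.1)%R).
  apply/measurable_fun_pairP; split => /=; first exact: measurable_fst.
  by apply: measurable_funD => //; exact: measurable_funM.
pose F1 := (fun z => F (z.1 + a * z.2, z.2)%R).
pose F2 := (fun z => F1 (z.1, z.2 + - s * z.1)%R).
have mF1 : measurable_fun setT F1 by exact: measurableT_comp.
have mF2 : measurable_fun setT F2 by exact: measurableT_comp.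
rewrite -(integral_shear1 a mF F0) -(integral_shear2 (- s) mF1 _); last by move=> z; exact: F0.
rewrite -(integral_shear1 a mF2 _); last by move=> z; exact: F0.
have as1 : a * s = 1 - c by rewrite divfK.
have ac : a * (1 + c) = s.
  by apply: (mulIf s0); rewrite mulrAC as1 -expr2; lra.
congr I; apply/funext => -[x y]; rewrite /F2 /F1 /=.
congr (F (_, _)).
- transitivity (x + a * (1 + 1) * y - (a * s) * x - (a * s) * a * y); last by ring.
  by rewrite as1 -[in LHS]ac; ring.
- transitivity (- s * x + y - (a * s) * y); last by ring.
  by rewrite as1; ring.
Qed.

Lemma product_normal_integral (sigma : R) (C : set (R * R)) : measurable C ->
  ((normal_prob 0 sigma \x normal_prob 0 sigma) C =
   I (fun z => (\1_C z * (normal_pdf 0 sigma z.1 * normal_pdf 0 sigma z.2))%:E))%E.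
Proof.
move=> mC; have mp := @measurable_normal_pdf R 0 sigma.
rewrite /I /product_measure1 /= ge0_integral_normal //; last first.
  exact: measurable_fun_xsection.
apply: eq_integral => x _.
rewrite /normal_prob integral_mkcond -ge0_integralZr //; last 3 first.
- apply/(measurable_restrictT _ _).1; first exact: measurable_xsection.
  by apply: measurable_funTS; exact/measurable_EFinP.
- by move=> y _; rewrite patchE; case: ifPn => // _; rewrite lee_fin normal_pdf_ge0.
- by rewrite lee_fin normal_pdf_ge0.
apply: eq_integral => y _; rewrite patchE mem_xsection indicE.
by case: ifPn => _; rewrite ?mul0e ?mul0r // mul1r -EFinM mulrC.
Qed.

Lemma normal_pdfM (sigma x y : R) : sigma != 0 ->
  normal_pdf 0 sigma x * normal_pdf 0 sigma y =
  normal_peak sigma ^+ 2 * expR (- (x ^+ 2 + y ^+ 2) / (sigma ^+ 2 *+ 2)).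
Proof.
move=> s0; rewrite !normal_pdfE // /normal_fun !subr0.
by rewrite mulrACA -expr2 -expRD -mulrDl -opprD.
Qed.

Lemma measurable_rotation_preimage (c s : R) (A B : set R) :
  measurable A -> measurable B ->
  measurable [set z : R * R | A (c * z.1 + s * z.2)%R /\ B (- s * z.1 + c * z.2)%R].
Proof.
move=> mA mB.
have mrot : measurable_fun setT
    (fun z : R * R => (c * z.1 + s * z.2, - s * z.1 + c * z.2)%R).
  apply/measurable_fun_pairP; split => /=.
    by apply: measurable_funD => //; exact: measurable_funM.
  by apply: measurable_funD => //; exact: measurable_funM.
by rewrite -[X in measurable X]setTI; apply: (mrot measurableT (A `*` B)); exact: measurableX.
Qed.

Lemma normal_rotation (c s sigma : R) (A B : set R) :
  sigma != 0 -> s != 0 -> c ^+ 2 + s ^+ 2 = 1 -> measurable A -> measurable B ->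
  ((normal_prob 0 sigma \x normal_prob 0 sigma)
    [set z : R * R | A (c * z.1 + s * z.2)%R /\ B (- s * z.1 + c * z.2)%R] =
   normal_prob 0 sigma A * normal_prob 0 sigma B)%E.
Proof.
move=> sn0 s0 cs mA mB; have mp := @measurable_normal_pdf R 0 sigma.
have mC := measurable_rotation_preimage c s mA mB.
have mAB : measurable (A `*` B) by exact: measurableX.
have <- := @product_measure1E _ _ _ _ _ (normal_prob 0 sigma) (normal_prob 0 sigma) A B mA mB.
etransitivity; first exact: product_normal_integral.
etransitivity; last by symmetry; exact: product_normal_integral.
pose G (z : R * R) := (\1_(A `*` B) z * (normal_pdf 0 sigma z.1 * normal_pdf 0 sigma z.2))%:E.
have mG : measurable_fun setT G.
  apply/measurable_EFinP; apply: measurable_funM; first exact: measurable_indic.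
  apply: measurable_funM.
    exact: (measurableT_comp mp measurable_fst).
  exact: (measurableT_comp mp measurable_snd).
have G0 z : (0 <= G z)%E by rewrite lee_fin !mulr_ge0 ?normal_pdf_ge0.
etransitivity; last exact: (integral_rotation s0 cs mG G0).
congr I; apply/funext => -[x y]; rewrite /G.
congr EFin; congr (_ * _).
rewrite /= !normal_pdfM //.
have -> : (c * x + s * y) ^+ 2 + (- s * x + c * y) ^+ 2 =
   (c ^+ 2 + s ^+ 2) * (x ^+ 2 + y ^+ 2) by ring.
by rewrite cs mul1r.
Qed.

End plane.

(** * White noise and plane rotations *)

(** Carrying the event [D] along lets one condition on the remaining coordinates: the measure
[m1] may then have total mass [P D] instead of 1. *)
Lemma joint_law (R : realType) (d d1 d2 : measure_display) (T : measurableType d)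
    (T1 : measurableType d1) (T2 : measurableType d2) (P : {measure set T -> \bar R})
    (X : T -> T1) (Y : T -> T2) (D : set T)
    (m1 : {sigma_finite_measure set T1 -> \bar R})
    (m2 : {sigma_finite_measure set T2 -> \bar R}) :
  measurable_fun setT X -> measurable_fun setT Y -> measurable D ->
  (forall A B, measurable A -> measurable B ->
     P (X @^-1` A `&` Y @^-1` B `&` D) = m1 A * m2 B)%E ->
  forall C, measurable C ->
    P ((fun t => (X t, Y t)) @^-1` C `&` D) = (m1 \x m2)%E C.
Proof.
move=> mX mY mD XY C mC.
have mXY : measurable_fun setT (fun t => (X t, Y t)) by exact: measurable_fun_pair.
pose XYm : {mfun T >-> (T1 * T2)%type} :=
  HB.pack (fun t => (X t, Y t)) (isMeasurableFun.Build _ _ _ _ _ mXY).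
pose m' := pushforward (mrestr P mD) XYm.
have -> := @product_measure_unique _ _ _ _ _ m1 m2 m' _ C mC; first by [].
by move=> A B mA mB; rewrite -XY.
Qed.

Section white.
Context {R : realType} {d : measure_display} {T : measurableType d}.
Variables (P : probability T R) (n : nat) (sigma : R).
Implicit Types w : 'I_n -> T -> R.

(** The product rule for all coordinates at once determines it for subfamilies, by taking
the whole line for the other coordinates. Plain functions are used instead of bundled
random variables, so that linear combinations need no repackaging. *)
Definition white w : Prop :=
  (forall i, measurable_fun setT (w i)) /\
  forall B : 'I_n -> set R, (forall i, measurable (B i)) ->
    P [set t | forall i, B i (w i t)] =
    (\prod_(i < n) normal_prob 0 sigma (B i))%E.

Lemma measurable_box w (Q : pred 'I_n) (B : 'I_n -> set R) :
  (forall i, measurable_fun setT (w i)) -> (forall i, measurable (B i)) ->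
  measurable [set t | forall i, Q i -> B i (w i t)].
Proof.
move=> mw mB.
have -> : [set t | forall i, Q i -> B i (w i t)] =
  \bigcap_(i in [set i | Q i]) (w i @^-1` B i) by [].
apply: fin_bigcap_measurable => // i _.
by rewrite -[X in measurable X]setTI; exact: mw.
Qed.

Definition rotate (i j : 'I_n) (c s : R) w : 'I_n -> T -> R := fun k t =>
  if k == i then c * w i t + s * w j t
  else if k == j then - s * w i t + c * w j t else w k t.

(** Conditionally on the other coordinates, the pair (w i, w j) has the rotation-invariant
law of two independent Gaussians. *)
Lemma white_rotate w (i j : 'I_n) (c s : R) :
  sigma != 0 -> i != j -> s != 0 -> c ^+ 2 + s ^+ 2 = 1 ->
  white w -> white (rotate i j c s w).
Proof.
move=> sn0 ij s0 cs [mw Pw]; split.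
  move=> k; rewrite /rotate; case: (k == i); last case: (k == j) => //.
    apply: (@measurable_funD _ _ _ _ (fun t => c * w i t) (fun t => s * w j t)).
      exact: (@measurable_funM _ _ _ _ (cst c) (w i)).
    exact: (@measurable_funM _ _ _ _ (cst s) (w j)).
  apply: (@measurable_funD _ _ _ _ (fun t => - s * w i t) (fun t => c * w j t)).
    exact: (@measurable_funM _ _ _ _ (cst (- s)) (w i)).
  exact: (@measurable_funM _ _ _ _ (cst c) (w j)).
move=> B mB.
have ji : j != i by rewrite eq_sym.
pose Q k := (k != i) && (k != j).
pose D := [set t | forall k, Q k -> B k (w k t)].
have mD : measurable D by exact: measurable_box.
pose C := [set z : R * R | B i (c * z.1 + s * z.2) /\ B j (- s * z.1 + c * z.2)].
have -> : [set t | forall k, B k (rotate i j c s w k t)] =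
    (fun t => (w i t, w j t)) @^-1` C `&` D.
  apply/seteqP; split => t /=.
    move=> h; split; first split => /=.
    - by have := h i; rewrite /rotate eqxx.
    - by have := h j; rewrite /rotate eqxx (negbTE ji).
    by move=> k /andP[/negbTE ki /negbTE kj]; have := h k; rewrite /rotate ki kj.
  move=> [[hi hj] hD] k; rewrite /rotate.
  have [->//|ki] := eqVneq k i; have [->//|kj] := eqVneq k j.
  by apply: hD; rewrite /Q ki kj.
have mC : measurable C by exact: measurable_rotation_preimage.
pose q := (\prod_(k < n | Q k) normal_prob 0 sigma (B k))%E.
have prodE (B' : 'I_n -> set R) : (forall k, Q k -> B' k = B k) ->
    (\prod_(k < n) normal_prob 0 sigma (B' k) =
     normal_prob 0 sigma (B' i) * (normal_prob 0 sigma (B' j) * q))%E.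
  move=> BB; rewrite (bigD1 i) //= (bigD1 j) //=; congr (_ * (_ * _))%E.
  by apply: eq_bigr => k kQ; rewrite BB.
have q0 : (0 <= q)%E.
  rewrite /q; apply: prode_ge0 => k _; exact: (measure_ge0 (normal_prob 0 sigma)).
have qfin : q \is a fin_num.
  apply: prode_fin_num => k _; apply: (fin_num_measure (normal_prob 0 sigma)).
  exact: mB.
(* [q] is the probability of the event [D] on the coordinates other than [i] and [j] *)
pose r : {nonneg R} := NngNum (fine_ge0 q0).
have rq : (r%:num)%:E = q by rewrite /= fineK.
pose N : {finite_measure set (measurableTypeR R) -> \bar R} := normal_prob 0 sigma.
pose rN : {finite_measure set (measurableTypeR R) -> \bar R} := mscale r N.
rewrite (@joint_law _ _ _ _ _ (measurableTypeR R) (measurableTypeR R) P (w i) (w j) D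
  rN N (mw i) (mw j) mD _ C mC).
- rewrite prodE //.
  transitivity (q * (normal_prob 0 sigma \x normal_prob 0 sigma)%E C)%E.
    rewrite /product_measure1 /= ge0_integral_mscale //; last first.
      exact: (measurable_fun_xsection N).
    by rewrite rq.
  by rewrite normal_rotation // muleC -muleA.
- move=> X Y mX mY.
  pose B' k := if k == i then X else if k == j then Y else B k.
  have mB' k : measurable (B' k).
    rewrite /B'; case: (k == i); first exact: mX.
    by case: (k == j); [exact: mY|exact: mB].
  transitivity (P [set t | forall k, B' k (w k t)]).
    congr (P _); apply/seteqP; split => t /=.
      move=> [[hX hY] hD] k; rewrite /B'.
      have [->//|ki] := eqVneq k i; have [->//|kj] := eqVneq k j.
      by apply: hD; rewrite /Q ki kj.
    move=> h; split; first split => /=.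
    - by have := h i; rewrite /B' eqxx.
    - by have := h j; rewrite /B' eqxx (negbTE ji).
    by move=> k /andP[/negbTE ki /negbTE kj]; have := h k; rewrite /B' ki kj.
  rewrite Pw // prodE; last by move=> k /andP[/negbTE ki /negbTE kj]; rewrite /B' ki kj.
  transitivity (q * N X * N Y)%E; last by rewrite -rq.
  by rewrite /B' eqxx (negbTE ji) eqxx muleA muleC muleA.
Qed.

End white.

(** * Independence and the chi-square tail *)

Lemma white_gaussian_white (R : realType) (d : measure_display) (T : measurableType d)
    (P : probability T R) (n : nat) (sigma : R) (w : 'I_n -> {RV P >-> R}) :
  white_gaussian sigma w -> white P sigma (fun i => w i).
Proof.
move=> [wN windep]; split; first by move=> i; exact: measurable_funP.
move=> B mB.
have := windep [set: 'I_n]%SET B mB.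
have -> : \bigcap_(i in [set` [set: 'I_n]%SET]) (w i @^-1` B i) = [set t | forall i, B i (w i t)].
  by apply/seteqP; split => t h i; [apply: h; rewrite /= inE|move=> _; exact: h].
move=> ->; rewrite big_mkcond /=; apply: eq_bigr => i _.
by rewrite inE -(wN i (B i) (mB i)).
Qed.

Section independence.
Context {R : realType} {d : measure_display} {T : measurableType d}.
Variables (P : probability T R) (n : nat) (sigma : R) (w : 'I_n -> T -> R).
Hypothesis ww : white P sigma w.

(** A pi-system that generates the sigma-algebra of the coordinates other than [i]. *)
Definition boxes (i : 'I_n) : set (set T) :=
  [set D | exists2 B : 'I_n -> set R, (forall k, measurable (B k)) &
     D = [set t | forall k, k != i -> B k (w k t)]].

(** Both sides are finite measures in [D] that agree on the boxes, which are stable under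
intersection and hence determine a measure on the sigma-algebra they generate. *)
Lemma white_indep_set (i : 'I_n) (B : set R) (D : set T) :
  measurable B -> <<s boxes i>> D ->
  P (w i @^-1` B `&` D) = (normal_prob 0 sigma B * P D)%E.
Proof.
have [mw Pw] := ww.
move=> mB sD.
have mwB : measurable (w i @^-1` B) by rewrite -[X in measurable X]setTI; exact: mw.
have mboxes : boxes i `<=` measurable.
  by move=> _ [C mC ->]; exact: (@measurable_box _ _ _ _ w (fun k => k != i)).
have N0 : 0 <= fine (normal_prob 0 sigma B).
  by rewrite fine_ge0 // (measure_ge0 (normal_prob 0 sigma)).
pose m1 : {measure set T -> \bar R} := mrestr P mwB.
pose m2 : {measure set T -> \bar R} := mscale (NngNum N0) P.
have NE : ((fine (normal_prob 0 sigma B))%:E = normal_prob 0 sigma B)%E.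
  by rewrite fineK //; exact: (fin_num_measure (normal_prob 0 sigma)).
rewrite setIC -[LHS]/(m1 D) -NE -[RHS]/(m2 D).
apply: (g_sigma_algebra_measure_unique (boxes i) mboxes (fun _ => setT) _ _ m1 m2) sD.
- move=> _; exists (fun _ => setT) => //.
  by apply/seteqP; split.
- by rewrite bigcup_const.
- move=> _ _ [C mC ->] [E mE ->]; exists (fun k => C k `&` E k).
    by move=> k; exact: measurableI.
  apply/seteqP; split => t /=; first by move=> [h1 h2] k ki; split; [exact: h1|exact: h2].
  by move=> h; split => k ki; case: (h k ki).
- move=> _ [C mC ->].
  have prodi (X : set R) : measurable X ->
      P (w i @^-1` X `&` [set t | forall k, k != i -> C k (w k t)]) =
      (normal_prob 0 sigma X * \prod_(k < n | k != i) normal_prob 0 sigma (C k))%E.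
    move=> mX; pose B' k := if k == i then X else C k.
    have mB' k : measurable (B' k) by rewrite /B'; case: (k == i); [exact: mX|exact: mC].
    transitivity (P [set t | forall k, B' k (w k t)]).
      congr (P _); apply/seteqP; split => t /=.
        by move=> [hX hC] k; rewrite /B'; have [->//|ki] := eqVneq k i; exact: hC.
      move=> h; split; first by have := h i; rewrite /B' eqxx.
      by move=> k /negbTE ki; have := h k; rewrite /B' ki.
    rewrite Pw // (bigD1 i) //= /B' eqxx; congr (_ * _)%E.
    by apply: eq_bigr => k /negbTE ->.
  rewrite -[LHS]/(P (_ `&` _)) -[RHS]/(_ * _)%E NE setIC prodi //.
  rewrite -[X in (_ * P X)%E](setTI) -[setT](preimage_setT (w i)) prodi //.
  by rewrite probability_setT mul1e.
- move=> k; rewrite -[X in (X < _)%E]/(P (_ `&` _)) ltey_eq fin_num_measure //.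
  exact: measurableI.
Qed.

(** That [f] is a function of the coordinates other than [i] is expressed as measurability
for the sigma-algebra they generate, so that closure under algebraic operations is that of
measurable functions. *)
Definition avoids (i : 'I_n) (f : T -> R) : Prop :=
  measurable_fun [set: g_sigma_algebraType (boxes i)] (f : g_sigma_algebraType (boxes i) -> R).

Lemma avoids_coord (i k : 'I_n) : k != i -> avoids i (w k).
Proof.
move=> ki _ Y mY; rewrite setTI; apply: sub_sigma_algebra.
exists (fun l => if l == k then Y else setT).
  by move=> l; case: (l == k); [exact: mY|exact: measurableT].
apply/seteqP; split => t /= h.
  by move=> l li; have [->|] := eqVneq l k.
by have := h k ki; rewrite eqxx.
Qed.

Lemma white_indep (i : 'I_n) (B C : set R) (f : T -> R) :
  measurable B -> measurable C -> avoids i f ->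
  P (w i @^-1` B `&` f @^-1` C) = (normal_prob 0 sigma B * P (f @^-1` C))%E.
Proof.
move=> mB mC mf; apply: white_indep_set => //.
by have := mf measurableT C mC; rewrite setTI.
Qed.

Lemma avoids_measurable (i : 'I_n) (f : T -> R) : avoids i f -> measurable_fun setT f.
Proof.
move=> mf _ Y mY; have := mf measurableT Y mY; rewrite !setTI.
apply: smallest_sub; first exact: sigma_algebra_measurable.
by move=> _ [C mC ->]; apply: (@measurable_box _ _ _ _ w (fun k => k != i)) => //; case: ww.
Qed.

Lemma avoids_sum (I : Type) (i : 'I_n) (s : seq I) (f : I -> T -> R) :
  (forall k, avoids i (f k)) -> avoids i (fun t => \sum_(k <- s) f k t).
Proof. by move=> fi; exact: measurable_sum. Qed.

Lemma avoids_cst (i : 'I_n) (c : R) : avoids i (fun _ => c).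
Proof. exact: measurable_cst. Qed.

Lemma avoidsM (i : 'I_n) (f g : T -> R) :
  avoids i f -> avoids i g -> avoids i (fun t => f t * g t).
Proof. exact: measurable_funM. Qed.

Lemma avoidsX (i : 'I_n) (f : T -> R) (k : nat) :
  avoids i f -> avoids i (fun t => f t ^+ k).
Proof. exact: measurable_funX. Qed.

(** Coordinate [i] is independent of the product over the remaining ones, so their joint law
is a product measure and the integral factors by Tonelli's theorem. *)
Lemma integral_prod_white (g : R -> R) (l : seq 'I_n) :
  measurable_fun setT g -> (forall x, 0 <= g x) -> uniq l ->
  (\int[P]_t (\prod_(j <- l) g (w j t))%:E =
   (\int[normal_prob 0 sigma]_x (g x)%:E) ^+ size l)%E.
Proof.
have [mw _] := ww.
move=> mg g0; elim: l => [_|i l IH].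
  under eq_integral do rewrite big_nil.
  by rewrite integral_cst // mul1e; exact: probability_setT.
rewrite cons_uniq => /andP[il ul]; pose Y t := \prod_(j <- l) g (w j t).
have aY : avoids i Y.
  apply: measurable_prod => j jl; apply: (measurableT_comp mg).
  by apply: avoids_coord; apply: contraNneq il => <-.
have mY := avoids_measurable aY.
have Y0 t : 0 <= Y t by apply: prodr_ge0.
pose Ym : {mfun T >-> measurableTypeR R} :=
  HB.pack (Y : T -> measurableTypeR R)
    (isMeasurableFun.Build _ _ _ (measurableTypeR R) Y mY).
pose N : probability (measurableTypeR R) R := normal_prob 0 sigma.
rewrite expeS.
have mwY : measurable_fun setT
    ((fun t => (w i t, Y t)) : T -> (measurableTypeR R * measurableTypeR R)%type).
  by apply: measurable_fun_pair; [exact: mw|exact: mY].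
(* the absolute value makes the integrand nonnegative on the whole plane *)
pose f (z : measurableTypeR R * measurableTypeR R) : \bar R := (`|g z.1 * z.2|)%:E.
have mf : measurable_fun setT f.
  apply/measurable_EFinP; apply: measurableT_comp => //.
  apply: measurable_funM; last exact: measurable_snd.
  have mg' : measurable_fun [set: measurableTypeR R] (g : measurableTypeR R -> R) by exact: mg.
  exact: (measurableT_comp mg' measurable_fst).
pose XY : {mfun T >-> (measurableTypeR R * measurableTypeR R)%type} :=
  HB.pack (fun t => (w i t, Y t)) (isMeasurableFun.Build _ _ _ _ _ mwY).
transitivity (\int[pushforward P XY]_z f z)%E.
  rewrite ge0_integral_pushforward //; last by move=> z _; rewrite lee_fin.
  apply: eq_integral => t _; rewrite /f /= ger0_norm ?mulr_ge0 //.
  by rewrite big_cons.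
transitivity (\int[N \x distribution P Ym]_z f z)%E.
  apply: eq_measure_integral => C mC _.
  rewrite -[LHS]/(P _) -[in LHS](setIT (_ @^-1` _)).
  apply: (@joint_law _ _ _ _ _ (measurableTypeR R) (measurableTypeR R) P (w i) Y setT N
    (distribution P Ym) (mw i) mY measurableT _ C mC).
  by move=> A B mA mB; rewrite setIT; exact: white_indep.
rewrite fubini_tonelli1 //; last by move=> z; rewrite lee_fin.
transitivity (\int[N]_x ((g x)%:E * \int[distribution P Ym]_y (`|y|)%:E))%E.
  apply: eq_integral => x _; rewrite /fubini_F /f /=.
  under eq_integral do rewrite normrM ger0_norm // EFinM.
  rewrite ge0_integralZl //; first exact/measurable_EFinP.
  by rewrite lee_fin.
rewrite ge0_integralZr //; last 3 first.
- exact/measurable_EFinP.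
- by move=> x _; rewrite lee_fin.
- by apply: integral_ge0 => x _; rewrite lee_fin.
congr (_ * _)%E; rewrite -IH // ge0_integral_distribution //.
- by apply: eq_integral => t _ /=; rewrite ger0_norm.
- exact/measurable_EFinP.
Qed.

(** Chernoff's bound with the exponent of [integral_normal_expR_sqr]. *)
Lemma chi_square_tail (l : seq 'I_n) (c : R) : 0 < sigma -> uniq l ->
  (P [set t | (c < \sum_(j <- l) w j t ^+ 2)%R] <=
   (expR (- (4 * sigma ^+ 2)^-1 * c) * Num.sqrt 2 ^+ size l)%:E)%E.
Proof.
have [mw _] := ww.
move=> s0 ul; pose a := (4 * sigma ^+ 2)^-1.
have a0 : 0 < a by rewrite invr_gt0 mulr_gt0 // exprn_gt0.
pose g x := expR (a * x ^+ 2).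
have mg : measurable_fun setT g.
  by apply: measurableT_comp => //; apply: measurable_funM.
have g0 x : 0 <= g x by exact: expR_ge0.
pose S t := \sum_(j <- l) w j t ^+ 2.
have mS : measurable_fun setT S.
  by apply: measurable_sum => j; exact: measurable_funX.
have mD : measurable [set t | c < S t].
  by rewrite -[X in measurable X]setTI; exact: measurable_fun_ltr.
have gS t : \prod_(j <- l) g (w j t) = expR (a * S t).
  by rewrite /S mulr_sumr expR_sum.
have := integral_prod_white mg g0 ul.
rewrite integral_normal_expR_sqr // => E.
rewrite EFinM EFin_expe -E -ge0_integralZl //; last 2 first.
- apply/measurable_EFinP; under eq_fun do rewrite gS.
  by apply: measurableT_comp => //; apply: measurable_funM.
- by move=> t _; rewrite lee_fin gS expR_ge0.
rewrite -[X in (P X <= _)%E]setIT -[X in (X <= _)%E]integral_indic //.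
apply: ge0_le_integral => //.
- by apply/measurable_EFinP; exact: measurable_indic.
- apply/measurable_EFinP; under eq_fun do rewrite gS.
  by apply: measurable_funM => //; apply: measurableT_comp => //; apply: measurable_funM.
move=> t _; rewrite -EFinM lee_fin gS -expRD indicE.
have [/set_mem /= ct|_] := boolP (_ \in _); last exact: expR_ge0.
rewrite -[leLHS]expR0 ler_expR mulNr addrC subr_ge0 ler_pM2l //.
exact: ltW.
Qed.

Lemma white_tail_indep (i : 'I_n) (tau : R) (C : set R) (f : T -> R) :
  0 < sigma -> 0 <= tau -> measurable C -> avoids i f ->
  (P ([set t | (tau < `|w i t|)%R] `&` f @^-1` C) <=
   (expR (- (tau ^+ 2 / (2 * sigma ^+ 2))))%:E * P (f @^-1` C))%E.
Proof.
move=> s0 t0 mC af.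
have mB : measurable [set x : R | tau < `|x|].
  by rewrite -[X in measurable X]setTI; exact: measurable_fun_ltr.
rewrite (_ : [set t | _] = w i @^-1` [set x | tau < `|x|]) // white_indep //.
by apply: lee_wpmul2r => //; exact: normal_tail.
Qed.

End independence.

(** * Inner products and isometries preserving white noise *)

Definition dot (R : realType) (k : nat) (u v : 'cV[R]_k) : R := (u^T *m v) 0 0.

Section dot_theory.
Context {R : realType}.

Lemma dotE k (u v : 'cV[R]_k) : dot u v = \sum_i u i 0 * v i 0.
Proof. by rewrite /dot mxE; apply: eq_bigr => i _; rewrite mxE. Qed.

Lemma dotC k (u v : 'cV[R]_k) : dot u v = dot v u.
Proof. by rewrite !dotE; apply: eq_bigr => i _; rewrite mulrC. Qed.

Lemma dotDr k (u v x : 'cV[R]_k) : dot u (v + x) = dot u v + dot u x.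
Proof. by rewrite /dot mulmxDr mxE. Qed.

Lemma dotNr k (u v : 'cV[R]_k) : dot u (- v) = - dot u v.
Proof. by rewrite /dot mulmxN mxE. Qed.

Lemma dotBr k (u v x : 'cV[R]_k) : dot u (v - x) = dot u v - dot u x.
Proof. by rewrite dotDr dotNr. Qed.

Lemma dotZr k (a : R) (u v : 'cV[R]_k) : dot u (a *: v) = a * dot u v.
Proof. by rewrite /dot -scalemxAr mxE. Qed.

Lemma dotDl k (u v x : 'cV[R]_k) : dot (u + v) x = dot u x + dot v x.
Proof. by rewrite dotC dotDr !(dotC x). Qed.

Lemma dotBl k (u v x : 'cV[R]_k) : dot (u - v) x = dot u x - dot v x.
Proof. by rewrite dotC dotBr !(dotC x). Qed.

Lemma dotZl k (a : R) (u v : 'cV[R]_k) : dot (a *: u) v = a * dot u v.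
Proof. by rewrite dotC dotZr dotC. Qed.

Lemma dot_ge0 k (u : 'cV[R]_k) : 0 <= dot u u.
Proof. by rewrite dotE; apply: sumr_ge0 => i _; rewrite -expr2 sqr_ge0. Qed.

Lemma dot_eq0 k (u : 'cV[R]_k) : (dot u u == 0) = (u == 0).
Proof.
apply/eqP/eqP => [|->]; last by rewrite dotE big1 // => i _; rewrite mxE mul0r.
rewrite dotE => /eqP; rewrite psumr_eq0 => [/allP h|i _]; last by rewrite -expr2 sqr_ge0.
apply/matrixP => i j; rewrite ord1 mxE.
by have := h i (mem_index_enum _); rewrite /= mulf_eq0 orbb => /eqP.
Qed.

Lemma dot_mulmxl k l (A : 'M[R]_(k, l)) (x : 'cV[R]_l) (v : 'cV[R]_k) :
  dot (A *m x) v = \sum_j x j 0 * dot (col j A) v.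
Proof.
rewrite /dot trmx_mul -mulmxA mxE; apply: eq_bigr => j _; rewrite mxE; congr (_ * _).
by rewrite !mxE; apply: eq_bigr => i _; rewrite !mxE.
Qed.

(** The vector <v, v> u - <u, v> v has a nonnegative square norm. *)
Lemma CauchySchwarz_dot k (u v : 'cV[R]_k) : dot u v ^+ 2 <= dot u u * dot v v.
Proof.
have [->|v0] := eqVneq v 0.
  by rewrite -(scale0r (0 : 'cV[R]_k)) !dotZr !mul0r expr0n mulr0.
have vv : 0 < dot v v by rewrite lt_def dot_eq0 v0 dot_ge0.
have := dot_ge0 (dot v v *: u - dot u v *: v).
have -> : dot (dot v v *: u - dot u v *: v) (dot v v *: u - dot u v *: v) =
    dot v v * (dot u u * dot v v - dot u v ^+ 2).
  by rewrite !(dotBl, dotBr, dotZl, dotZr) (dotC v u); ring.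
by rewrite pmulr_rge0 // subr_ge0.
Qed.

Lemma l2normE k (u : 'cV[R]_k) : l2norm u = Num.sqrt (dot u u).
Proof. by rewrite /l2norm dotE; congr Num.sqrt; apply: eq_bigr => i _; rewrite expr2. Qed.

Lemma l2norm_sqr k (u : 'cV[R]_k) : l2norm u ^+ 2 = dot u u.
Proof. by rewrite l2normE sqr_sqrtr // dot_ge0. Qed.

End dot_theory.

Section orthogonal.
Context {R : realType} {d : measure_display} {T : measurableType d}.
Variables (P : probability T R) (n : nat) (sigma : R).
Hypothesis sigma_neq0 : sigma != 0.
Implicit Types (Q : 'M[R]_n) (v : 'cV[R]_n) (w : 'I_n -> T -> R).

Definition mix Q w : 'I_n -> T -> R := fun i t => (Q *m \col_j w j t) i 0.

(** All orthogonal matrices have this property; the class below is closed under products and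
contains the plane rotations, which suffice to triangularise. *)
Definition white_isometry Q : Prop :=
  (forall u v, dot (Q *m u) (Q *m v) = dot u v) /\
  (forall w, white P sigma w -> white P sigma (mix Q w)).

Lemma col_mix Q w t : \col_j mix Q w j t = Q *m \col_j w j t.
Proof. by apply/matrixP => i j; rewrite mxE ord1. Qed.

Lemma white_isometry1 : white_isometry 1%:M.
Proof.
split=> [u v|w ww]; first by rewrite !mul1mx.
by rewrite (_ : mix _ _ = w) //; apply/funext => i; apply/funext => t; rewrite /mix mul1mx mxE.
Qed.

Lemma white_isometryM Q1 Q2 :
  white_isometry Q1 -> white_isometry Q2 -> white_isometry (Q1 *m Q2).
Proof.
move=> [iso1 w1] [iso2 w2]; split=> [u v|w ww]; first by rewrite -!mulmxA iso1.
rewrite (_ : mix _ _ = mix Q1 (mix Q2 w)); first by apply: w1; exact: w2.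
apply/funext => i; apply/funext => t.
transitivity ((Q1 *m (Q2 *m \col_j w j t)) i 0); first by rewrite mulmxA.
by rewrite -col_mix.
Qed.

Definition givens (i j : 'I_n) (c s : R) : 'M[R]_n :=
  \matrix_k (if k == i then c *: delta_mx 0 i + s *: delta_mx 0 j
             else if k == j then - s *: delta_mx 0 i + c *: delta_mx 0 j
             else delta_mx 0 k).

Lemma givensE i j c s v k : (givens i j c s *m v) k 0 =
  if k == i then c * v i 0 + s * v j 0
  else if k == j then - s * v i 0 + c * v j 0 else v k 0.
Proof.
transitivity ((row k (givens i j c s *m v)) 0 0); first by rewrite [RHS]mxE.
rewrite row_mul rowK; case: ifP => _; last case: ifP => _.
- by rewrite mulmxDl -!scalemxAl -!rowE !mxE.
- by rewrite mulmxDl -!scalemxAl -!rowE !mxE.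
- by rewrite -rowE mxE.
Qed.

Lemma givens_isometry (i j : 'I_n) (c s : R) : i != j -> s != 0 ->
  c ^+ 2 + s ^+ 2 = 1 -> white_isometry (givens i j c s).
Proof.
move=> ij s0 cs; have ji : j != i by rewrite eq_sym.
split=> [u v|w ww].
  have dot_ij (x y : 'cV[R]_n) : dot x y = x i 0 * y i 0 + x j 0 * y j 0 +
      \sum_(k | (k != i) && (k != j)) x k 0 * y k 0.
    by rewrite dotE (bigD1 i) //= (bigD1 j) //= addrA.
  rewrite !dot_ij !givensE eqxx (negbTE ji) eqxx; congr (_ + _); last first.
    by apply: eq_bigr => k /andP[/negbTE ki /negbTE kj]; rewrite !givensE ki kj.
  transitivity ((c ^+ 2 + s ^+ 2) * (u i 0 * v i 0 + u j 0 * v j 0)); first by ring.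
  by rewrite cs mul1r.
rewrite (_ : mix _ _ = rotate i j c s w); first exact: white_rotate.
by apply/funext => k; apply/funext => t; rewrite /mix givensE /rotate !mxE.
Qed.

(** The entries at [l] are rotated into entry [k] one at a time. The two clauses on other
vectors allow several such steps to be composed without undoing the zeros already
obtained. *)
Lemma white_isometry_clear (k : 'I_n) (l : seq 'I_n) v : uniq (k :: l) ->
  exists Q, [/\ white_isometry Q,
    forall (u : 'cV[R]_n) i, i \notin k :: l -> (Q *m u) i 0 = u i 0,
    forall u : 'cV[R]_n, (forall i, i \in k :: l -> u i 0 = 0) -> Q *m u = u &
    forall i, i \in l -> (Q *m v) i 0 = 0].
Proof.
elim: l => [_|j l IH].
  by exists 1%:M; split => [|u i _|u _|//]; rewrite ?mul1mx //; exact: white_isometry1.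
rewrite /= inE negb_or => /and3P[/andP[kj kl] jl ul].
have [|Q [Qiso Qout Qfix Qv]] := IH; first by rewrite /= kl.
pose x := Q *m v.
have [xj|xj] := eqVneq (x j 0) 0.
  exists Q; split=> //.
  - by move=> u i il; apply: Qout; move: il; rewrite !inE !negb_or => /and3P[-> _ ->].
  - by move=> u u0; apply: Qfix => i il; apply: u0; move: il; rewrite !inE => /orP[->//|->]; rewrite !orbT.
  - by move=> i; rewrite inE => /orP[/eqP->|/Qv].
have r2 : 0 < x k 0 ^+ 2 + x j 0 ^+ 2 by rewrite ltr_wpDl ?sqr_ge0 // exprn_even_gt0.
pose r := Num.sqrt (x k 0 ^+ 2 + x j 0 ^+ 2).
have r0 : r != 0 by rewrite gt_eqF // sqrtr_gt0.
have rr : r ^+ 2 = x k 0 ^+ 2 + x j 0 ^+ 2 by rewrite sqr_sqrtr // ltW.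
exists (givens k j (x k 0 / r) (x j 0 / r) *m Q); split.
- apply: white_isometryM => //; apply: givens_isometry => //.
    by rewrite mulf_neq0 // invr_eq0.
  by rewrite !expr_div_n -mulrDl -rr divff // sqrf_eq0.
- move=> u i; rewrite !inE !negb_or => /and3P[/negbTE ik /negbTE ij il].
  by rewrite -mulmxA givensE ik ij Qout // inE negb_or ik.
- move=> u u0; rewrite -mulmxA Qfix; last first.
    by move=> i il; apply: u0; move: il; rewrite !inE => /orP[->//|->]; rewrite !orbT.
  apply/matrixP => i z; rewrite ord1 givensE.
  rewrite (u0 k) ?inE ?eqxx // (u0 j) ?inE ?eqxx ?orbT // !mulr0 addr0.
  have [->|_] := eqVneq i k; first by rewrite u0 // inE eqxx.
  by have [->|//] := eqVneq i j; rewrite u0 // !inE eqxx orbT.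
- move=> i; rewrite inE -mulmxA givensE -/x => /orP[/eqP->|il].
    by rewrite eq_sym (negbTE kj) eqxx; ring.
  have [ik|_] := eqVneq i k; first by rewrite -ik il in kl.
  have [ij|_] := eqVneq i j; first by rewrite -ij il in jl.
  exact: Qv.
Qed.

(** Givens triangularisation: the step for the vector number k acts on the coordinates from
k on only, where the previous vectors already vanish. *)
Lemma white_isometry_triangular (s : seq 'cV[R]_n) :
  exists2 Q, white_isometry Q &
    forall v, v \in s -> forall i : 'I_n, (size s <= i)%N -> (Q *m v) i 0 = 0.
Proof.
elim/last_ind: s => [|s v [Q Qiso Qs]].
  by exists 1%:M => //; exact: white_isometry1.
have [ns|sn] := leqP n (size s).
  exists Q => // u _ i; rewrite size_rcons => si.
  by have := ltn_trans (leq_trans (ltn_ord i) ns) si; rewrite ltnn.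
pose k := Ordinal sn.
pose l := [seq i : 'I_n <- enum 'I_n | (k < i)%N].
have ul : uniq (k :: l) by rewrite /= mem_filter ltnn /= filter_uniq // enum_uniq.
have [Q' [Q'iso Q'out Q'fix Q'v]] := white_isometry_clear (Q *m v) ul.
exists (Q' *m Q); first exact: white_isometryM.
move=> u; rewrite mem_rcons inE => /orP[/eqP->|us] i; rewrite size_rcons => si.
  by rewrite -mulmxA Q'v // mem_filter mem_enum andbT.
rewrite -mulmxA Q'fix; first by apply: Qs => //; exact: ltnW.
move=> z; rewrite inE mem_filter mem_enum andbT => /orP[/eqP->|kz]; apply: Qs => //.
exact: ltnW.
Qed.

End orthogonal.

(** * The objective and its minimisers *)

Section bpdn.
Context {R : realType} {n m : nat}.
Variables (A : 'M[R]_(n, m)) (b : 'cV[R]_n) (gamma : R).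
Hypothesis gamma_gt0 : 0 < gamma.
Local Notation obj := (bpdn_objective A b gamma).
Implicit Types x y h : 'cV[R]_m.

Lemma objE x : obj x = 2^-1 * dot (b - A *m x) (b - A *m x) + gamma * l1norm x.
Proof. by rewrite /bpdn_objective l2norm_sqr. Qed.

Lemma obj_shift x h : obj (x + h) = obj x +
  (2^-1 * dot (A *m h) (A *m h) - dot (A *m h) (b - A *m x) +
   gamma * (l1norm (x + h) - l1norm x)).
Proof.
rewrite !objE mulmxDr opprD addrA.
move: (b - A *m x) (A *m h) => r z.
rewrite !(dotBl, dotBr) (dotC r z); by field.
Qed.

Lemma obj_continuous : continuous (fun v : 'rV[R]_m => obj v^T).
Proof.
have -> : (fun v : 'rV[R]_m => obj v^T) = (fun v : 'rV[R]_m =>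
    2^-1 * (\sum_(k < n) (b k 0 - \sum_(j < m) A k j * v ord0 j) ^+ 2)
    + gamma * (\sum_(j < m) `|v ord0 j|)).
  apply/funext => v; rewrite objE dotE /l1norm; congr (_ * _ + _ * _).
    by apply: eq_bigr => k _; rewrite -expr2 !mxE; congr ((_ - _) ^+ 2);
       apply: eq_bigr => j _; rewrite mxE.
  by apply: eq_bigr => j _; rewrite mxE.
have sumc (I : finType) (f : I -> 'rV[R]_m -> R) : (forall i, continuous (f i)) ->
    continuous (fun v => \sum_i f i v).
  by move=> fc; apply: continuous_big => //; exact: add_continuous.
have cc (j : 'I_m) : continuous (fun v : 'rV[R]_m => v ord0 j).
  by move=> v; exact: coord_continuous.
have cD (f g : 'rV[R]_m -> R) : continuous f -> continuous g ->
    continuous (fun v => f v + g v).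
  by move=> cf cg v; apply: (@continuousD _ _ _ f g); [exact: cf|exact: cg].
have cM (f g : 'rV[R]_m -> R) : continuous f -> continuous g ->
    continuous (fun v => f v * g v).
  by move=> cf cg v; apply: (@continuousM _ _ f g); [exact: cf|exact: cg].
have cst (a : R) : continuous (fun _ : 'rV[R]_m => a) by exact: cst_continuous.
apply: (cD _ _); apply: (cM _ _) => //.
  apply: (sumc _ (fun k v => _)) => k.
  have cb : continuous (fun v : 'rV[R]_m => b k 0 - \sum_(j < m) A k j * v ord0 j).
    apply: (cD _ _) => //.
    have cS : continuous (fun v : 'rV[R]_m => \sum_(j < m) A k j * v ord0 j).
      by apply: (sumc _ (fun j v => _)) => j; exact: (cM _ _).
    by move=> v; apply: continuousN; exact: cS.
  by under eq_fun do rewrite expr2; exact: (cM _ _).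
apply: (sumc _ (fun j (v : 'rV[R]_m) => `|v ord0 j|)) => j v; apply: (continuous_comp (cc j v)); exact: norm_continuous.
Qed.

(** Boxes are allowed to be degenerate in some coordinates, which covers both coordinate
subspaces and the faces of a cube. *)
Lemma obj_box_min (lo hi : 'I_m -> R) : (forall i, lo i <= hi i) ->
  exists2 x : 'cV[R]_m, (forall i, lo i <= x i 0 <= hi i) &
    forall y, (forall i, lo i <= y i 0 <= hi i) -> obj x <= obj y.
Proof.
move=> lohi.
pose K := [set v : 'rV[R]_m | forall i, `[lo i, hi i]%classic (v ord0 i)].
have cK : compact K.
  by apply: (@rV_compact _ _ (fun i => `[lo i, hi i]%classic)) => i; exact: segment_compact.
have K0 : K !=set0.
  by exists (\row_i lo i) => i /=; rewrite mxE in_itv /= lexx lohi.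
have [|v vK vmin] := EVT_min_rV K0 cK (f := fun v => obj v^T).
  exact/continuous_subspaceT/obj_continuous.
exists v^T.
  by move=> i; have := set_mem vK i; rewrite /= in_itv mxE.
move=> y yb; rewrite -[y]trmxK; apply: vmin; apply/mem_set => i /=.
by rewrite in_itv mxE; exact: yb.
Qed.

(** The l1 term makes the objective exceed its value at 0 outside a cube, so that it is
enough to minimise over a box. *)
Lemma obj_min_on (S : {set 'I_m}) :
  exists2 x : 'cV[R]_m, (forall i, i \notin S -> x i 0 = 0) &
    forall y, (forall i, i \notin S -> y i 0 = 0) -> obj x <= obj y.
Proof.
pose M := obj 0 / gamma.
have obj_ge0 y : 0 <= 2^-1 * dot (b - A *m y) (b - A *m y).
  by rewrite mulr_ge0 ?dot_ge0 // invr_ge0.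
have l1_ge0 y : 0 <= l1norm y by apply: sumr_ge0.
have M0 : 0 <= M.
  by apply: divr_ge0; [rewrite objE addr_ge0 // mulr_ge0 // ltW|exact: ltW].
pose u i := if i \in S then M else 0.
have u0 i : 0 <= u i by rewrite /u; case: ifP.
have [|x xb xmin] := obj_box_min (lo := fun i => - u i) (hi := u).
  by move=> i; rewrite (le_trans _ (u0 i)) // oppr_le0.
exists x.
  by move=> i /negbTE iS; have := xb i; rewrite /u iS oppr0 => h; apply/eqP; rewrite eq_le andbC.
move=> y yS.
have [yb|/existsNP[i]] := pselect (forall i, - u i <= y i 0 <= u i); first exact: xmin.
rewrite -ler_norml => /negP; rewrite -ltNge => yi.
apply: (@le_trans _ _ (obj 0)).
  by apply: xmin => j; rewrite mxE oppr_le0 u0.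
have iS : i \in S by apply: contraLR yi => iS; rewrite yS // normr0 -leNgt.
apply: (@le_trans _ _ (gamma * `|y i 0|)).
  by rewrite -ler_pdivrMl // mulrC ltW //; move: yi; rewrite /u iS.
rewrite objE; apply: ler_wpDl => //.
rewrite ler_pM2l // /l1norm (bigD1 i) //= lerDl; exact: sumr_ge0.
Qed.

(** Along the segment from [x] to [y] the quadratic term is of second order, so that only the
convexity of the absolute value remains to first order. *)
Lemma subgradient_of_min (x g : R) :
  (forall h : R, 0 <= 2^-1 * h ^+ 2 - h * g + gamma * (`|x + h| - `|x|)) ->
  forall y : R, g * (y - x) <= gamma * (`|y| - `|x|).
Proof.
move=> hmin y; rewrite leNgt; apply/negP => lt.
pose e := gamma * (`|y| - `|x|) - g * (y - x).
have e0 : e < 0 by rewrite subr_lt0.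
pose D := (y - x) ^+ 2.
have D0 : 0 <= D by exact: sqr_ge0.
(* if the inequality fails by - e > 0, a step [t] with t D <= - e already decreases the
   objective *)
pose t := - e / (D - e).
have De : 0 < D - e by lra.
have t0 : 0 < t by rewrite divr_gt0 // oppr_gt0.
have t1 : t <= 1 by rewrite ler_pdivrMr // mul1r; lra.
have tD : t * D <= - e.
  rewrite /t mulrAC ler_pdivrMr // ler_wpM2l //; first lra.
  by lra.
clearbody t; have := hmin (t * (y - x)).
have -> : x + t * (y - x) = (1 - t) * x + t * y by ring.
have n1 : `|(1 - t) * x + t * y| <= (1 - t) * `|x| + t * `|y|.
  apply: le_trans (ler_normD _ _) _.
  have t1' : 0 <= 1 - t by rewrite subr_ge0.
  by rewrite !normrM (ger0_norm t1') (gtr0_norm t0).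
have : gamma * (`|(1 - t) * x + t * y| - `|x|) <= gamma * (t * (`|y| - `|x|)).
  rewrite ler_pM2l //; lra.
have -> : 2^-1 * (t * (y - x)) ^+ 2 = t * (2^-1 * (t * D)) by rewrite /D; ring.
move=> h1 h2.
have : 0 <= t * (2^-1 * (t * D) + e).
  apply: le_trans h2 _; rewrite /e.
  have -> : t * (2^-1 * (t * D) + (gamma * (`|y| - `|x|) - g * (y - x))) =
    t * (2^-1 * (t * D)) - t * (y - x) * g + gamma * (t * (`|y| - `|x|)) by ring.
  by rewrite lerD2l.
rewrite pmulr_rge0 //; lra.
Qed.

End bpdn.

(** * Gram matrices of low coherence *)

Section recovery.
Context {R : realType} {n m : nat}.
Variables (A : 'M[R]_(n, m)) (S : {set 'I_m}).
Local Notation a := (fun i => col i A).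
Local Notation mu := (coherence A).
Hypothesis A_unit : forall i, dot (a i) (a i) = 1.
Hypothesis S_small : 3 * (#|S|%:R * mu) < 1.
Implicit Types z : 'cV[R]_m.

Definition supported z : Prop := forall i, i \notin S -> z i 0 = 0.

Lemma coherence_ge i j : i != j -> `|dot (a i) (a j)| <= mu.
Proof.
move=> ij; exact: (@le_bigmax_cond _ _ _ _ (i, j) (fun ij => ij.1 != ij.2)
  (fun ij => `|((col ij.1 A)^T *m col ij.2 A) 0 0|) ij).
Qed.

Lemma coherence_ge0 : 0 <= mu.
Proof. exact: bigmax_ge_id. Qed.

Lemma l1_supported z M : supported z -> (forall i, i \in S -> `|z i 0| <= M) ->
  l1norm z <= #|S|%:R * M.
Proof.
move=> zS zM; rewrite /l1norm (bigID (mem S)) /= [X in _ + X]big1 ?addr0; last first.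
  by move=> i /zS ->; rewrite normr0.
by rewrite mulr_natl -sumr_const; apply: ler_sum.
Qed.

(** Cauchy-Schwarz against the indicator of [S]. *)
Lemma sqr_l1_supported z : supported z -> l1norm z ^+ 2 <= #|S|%:R * dot z z.
Proof.
move=> zS.
pose e : 'cV[R]_m := \col_i (i \in S)%:R.
pose y : 'cV[R]_m := \col_i `|z i 0|.
have -> : l1norm z = dot e y.
  rewrite dotE; apply: eq_bigr => i _; rewrite !mxE.
  by have [iS|/zS ->] := boolP (i \in S); rewrite ?mul1r // normr0 mulr0.
have -> : #|S|%:R = dot e e.
  rewrite dotE -sum1_card natr_sum big_mkcond; apply: eq_bigr => i _ /=.
  by rewrite !mxE; case: (i \in S); rewrite ?mulr1 ?mulr0.
have -> : dot z z = dot y y.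
  by rewrite !dotE; apply: eq_bigr => i _; rewrite !mxE -!expr2 real_normK ?num_real.
exact: CauchySchwarz_dot.
Qed.

(** The Gram matrix has unit diagonal and off-diagonal entries at most the coherence. *)
Lemma gram_row z i : `|dot (a i) (A *m z) - z i 0| <= mu * l1norm z.
Proof.
rewrite dotC dot_mulmxl (bigD1 i) //= A_unit mulr1 addrAC subrr add0r.
apply: le_trans (ler_norm_sum _ _ _) _.
rewrite /l1norm mulr_sumr [leRHS](bigD1 i) //=.
apply: ler_wpDl; first by rewrite mulr_ge0 // coherence_ge0.
apply: ler_sum => j ji; rewrite normrM mulrC ler_wpM2r //.
exact: coherence_ge.
Qed.

(** Diagonal dominance: at an index where |z_i| is largest, the off-diagonal terms amount to
at most a third of |z_i|. *)
Lemma gram_sup z g : supported z -> 0 <= g ->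
  (forall i, i \in S -> `|dot (a i) (A *m z)| <= g) ->
  forall i, `|z i 0| <= 3 / 2 * g.
Proof.
move=> zS g0 zg i.
have [iS|/zS ->] := boolP (i \in S); last by rewrite normr0 mulr_ge0 // divr_ge0.
have [k kS kmax] := @arg_maxP _ _ _ i (mem S) (fun i => `|z i 0|) iS.
apply: (le_trans (kmax i iS)).
have l1 := l1_supported zS kmax.
have row := gram_row z k.
have : `|z k 0| <= g + mu * (#|S|%:R * `|z k 0|).
  have -> : z k 0 = dot (a k) (A *m z) - (dot (a k) (A *m z) - z k 0) by rewrite opprB addrC subrK.
  apply: le_trans (ler_normB _ _) _; apply: lerD; first exact: zg.
  apply: le_trans row _; rewrite opprB addrC subrK.
  by rewrite ler_wpM2l // coherence_ge0.
rewrite mulrA [mu * _]mulrC.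
have : 0 <= `|z k 0| by [].
move: S_small; nra.
Qed.

(** The strict inequality comes from that of the sparsity assumption and is what makes the
dual certificate strict. *)
Lemma gram_off z g i : supported z -> 0 < g -> i \notin S ->
  (forall i, `|z i 0| <= 3 / 2 * g) ->
  `|dot (a i) (A *m z)| < g / 2.
Proof.
move=> zS g0 iS zg; have := gram_row z i; rewrite (zS i iS) subr0 => /le_lt_trans; apply.
have l1 := l1_supported zS (fun i _ => zg i).
apply: le_lt_trans (ler_wpM2l coherence_ge0 l1) _.
rewrite mulrA [mu * _]mulrC; move: S_small; nra.
Qed.

(** The columns in [S] are well conditioned; in particular they are linearly independent. *)
Lemma gram_sqr z : supported z -> dot z z <= 3 / 2 * dot (A *m z) (A *m z).
Proof.
move=> zS.
have h : dot z z - dot (A *m z) (A *m z) <= mu * l1norm z ^+ 2.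
  rewrite dot_mulmxl dotE -sumrB [leRHS]mulrA [leRHS]mulrC /l1norm mulr_suml.
  apply: ler_sum => i _; rewrite -mulrBr; apply: le_trans (ler_norm _) _.
  by rewrite normrM ler_wpM2l // distrC; exact: gram_row.
have l1 := sqr_l1_supported zS.
have := le_trans h (ler_wpM2l coherence_ge0 l1).
rewrite mulrA [mu * _]mulrC.
have := dot_ge0 z; move: S_small; nra.
Qed.

End recovery.

(** * Deterministic recovery *)

Section recovery.
Context {R : realType} {n m : nat}.
Variables (A : 'M[R]_(n, m)) (S : {set 'I_m}).
Local Notation a := (fun i => col i A).
Local Notation mu := (coherence A).
Hypothesis A_unit : forall i, dot (a i) (a i) = 1.
Hypothesis S_small : 3 * (#|S|%:R * mu) < 1.
Implicit Types (x z : 'cV[R]_m) (w : 'cV[R]_n).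

Lemma mulmx_delta i (t : R) : A *m (t *: delta_mx i 0) = t *: col i A.
Proof. by rewrite -scalemxAr colE. Qed.

Lemma l1norm_coord x i t : l1norm (x + t *: delta_mx i 0) - l1norm x =
  `|x i 0 + t| - `|x i 0|.
Proof.
rewrite /l1norm (bigD1 i) //= [\sum_(i < m) `|x i 0|](bigD1 i) //= !mxE !eqxx mulr1.
rewrite (eq_bigr (fun j => `|x j 0|)); first by ring.
by move=> j /negbTE ji; rewrite !mxE ji mulr0 addr0.
Qed.

Lemma min_on_subgradient b gamma x : 0 < gamma -> supported S x ->
  (forall y, supported S y -> bpdn_objective A b gamma x <= bpdn_objective A b gamma y) ->
  forall i, i \in S -> forall y : R,
    dot (a i) (b - A *m x) * (y - x i 0) <= gamma * (`|y| - `|x i 0|).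
Proof.
move=> g0 xS xmin i iS; apply: subgradient_of_min => // h.
have := xmin (x + h *: delta_mx i 0).
rewrite obj_shift lerDl mulmx_delta !dotZl dotZr A_unit l1norm_coord mulr1 -expr2; apply.
move=> j jS; rewrite !mxE xS // add0r (_ : (j == i) = false) ?mulr0 //.
by apply: contraNF jS => /eqP ->.
Qed.

(** With g the vector of correlations <a_i, b - A x>, the increase of the objective from x to
y is |A (y - x)|^2 / 2 plus a sum over i of gaps gamma (|y_i| - |x_i|) - g_i (y_i - x_i).
The gaps are nonnegative, on S by optimality of x there, and off S because |g_i| < gamma,
in which case they vanish only for y_i = 0. Hence another minimiser y is supported by S with
A (y - x) = 0, and the columns in S are independent. *)
Lemma dual_certificate b gamma x : 0 < gamma -> supported S x ->
  (forall y, supported S y -> bpdn_objective A b gamma x <= bpdn_objective A b gamma y) ->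
  (forall i, i \notin S -> `|dot (a i) (b - A *m x)| < gamma) ->
  unique (bpdn_solution A b gamma) x.
Proof.
move=> g0 xS xmin off; set r := b - A *m x in off *.
have sub := min_on_subgradient g0 xS xmin.
pose gap i (t : R) := gamma * (`|t| - `|x i 0|) - dot (a i) r * (t - x i 0).
have gap0 i t : 0 <= gap i t.
  have [iS|iS] := boolP (i \in S); first by rewrite subr_ge0; exact: sub.
  rewrite /gap xS // normr0 !subr0 subr_ge0; apply: le_trans (ler_norm _) _.
  by rewrite normrM ler_wpM2r // ltW // off.
have gap_off i t : i \notin S -> gap i t = 0 -> t = 0.
  move=> iS; rewrite /gap xS // normr0 !subr0 => /eqP; rewrite subr_eq0 => /eqP e.
  have := off i iS; apply: contraTeq => t0; rewrite -leNgt -(ler_pM2r (x := `|t|)) ?normr_gt0 //.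
  by rewrite e -normrM ler_norm.
have objy y : bpdn_objective A b gamma y = bpdn_objective A b gamma x +
    (2^-1 * dot (A *m (y - x)) (A *m (y - x)) + \sum_i gap i (y i 0)).
  have {1}-> : y = x + (y - x) by rewrite addrC subrK.
  rewrite obj_shift; congr (_ + _); rewrite -addrA; congr (_ + _).
  have -> : x + (y - x) = y by rewrite addrC subrK.
  rewrite /gap sumrB addrC; congr (_ - _).
    by rewrite /l1norm -sumrB mulr_sumr.
  by rewrite dot_mulmxl; apply: eq_bigr => i _; rewrite !mxE mulrC.
have q0 (y : 'cV[R]_m) : 0 <= 2^-1 * dot (A *m (y - x)) (A *m (y - x)).
  by rewrite mulr_ge0 ?dot_ge0 // invr_ge0.
have G0 (y : 'cV[R]_m) : 0 <= \sum_i gap i (y i 0) by apply: sumr_ge0.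
have xsol : bpdn_solution A b gamma x.
  by move=> y; rewrite (objy y) lerDl addr_ge0.
split=> // y ysol; have := ysol x; rewrite (objy y) gerDl => le0.
have e1 : \sum_i gap i (y i 0) = 0 by have := q0 y; have := G0 y; lra.
have e2 : dot (A *m (y - x)) (A *m (y - x)) = 0 by have := q0 y; have := G0 y; lra.
have yS : supported S y.
  move=> i iS; apply: (gap_off i) => //; move/eqP: e1.
  by rewrite psumr_eq0 // => /allP/(_ i (mem_index_enum _))/eqP.
have zS : supported S (y - x) by move=> i iS; rewrite !mxE xS // yS // subrr.
have := gram_sqr A_unit S_small zS; rewrite e2 mulr0 => yx0.
have /eqP : dot (y - x) (y - x) = 0 by apply/eqP; rewrite eq_le yx0 dot_ge0.
by rewrite dot_eq0 subr_eq0 => /eqP.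
Qed.

Lemma dot_le_sup z M : supported S z -> 0 <= M -> (forall i, `|z i 0| <= M) ->
  dot z z <= #|S|%:R * M ^+ 2.
Proof.
move=> zS M0 zM; apply: (@le_trans _ _ (M * l1norm z)).
  rewrite dotE mulr_sumr; apply: ler_sum => i _.
  by rewrite -expr2 -real_normK ?num_real // expr2 ler_wpM2r.
have := ler_wpM2l M0 (l1_supported zS (fun i _ => zM i)).
by rewrite expr2 [X in _ <= X -> _]mulrCA.
Qed.

Lemma dot_triangle z u (s al be : R) : 0 <= s -> 0 <= al -> 0 <= be ->
  dot z z <= s * al ^+ 2 -> dot u u <= s * be ^+ 2 ->
  dot (z - u) (z - u) <= (be + al) ^+ 2 * s.
Proof.
move=> s0 al0 be0 zz uu.
have zu : `|dot z u| <= s * al * be.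
  rewrite -ler_sqr ?nnegrE ?mulr_ge0 // real_normK ?num_real //.
  apply: le_trans (CauchySchwarz_dot z u) _.
  have -> : (s * al * be) ^+ 2 = (s * al ^+ 2) * (s * be ^+ 2) by ring.
  by apply: ler_pM => //; exact: dot_ge0.
rewrite !(dotBl, dotBr) (dotC u z).
move: zu; rewrite ler_norml => /andP[h _]; nra.
Qed.

(** The error splits as the error u of the least squares fit, bounded through [gram_sqr], and
the bias z due to the l1 penalty, bounded through [gram_sup]. *)
Lemma recovery (sigma gamma : R) x0 w u : 0 < sigma -> 0 < gamma ->
  supported S x0 -> supported S u ->
  (forall i, i \in S -> dot (a i) (w - A *m u) = 0) ->
  (forall i, i \notin S -> `|dot (a i) (w - A *m u)| <= gamma / 2) ->
  dot (A *m u) (A *m u) <= 2 * #|S|%:R * sigma ^+ 2 ->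
  exists2 x, unique (bpdn_solution A (A *m x0 + w) gamma) x &
    l2norm (x0 - x) ^+ 2 <= (sigma * Num.sqrt 3 + 3 / 2 * gamma) ^+ 2 * #|S|%:R.
Proof.
move=> sg0 g0 x0S uS won woff Au.
set b := A *m x0 + w.
have [x xS xmin] := obj_min_on A b g0 S.
pose z := x0 + u - x.
have zS : supported S z by move=> i iS; rewrite !mxE x0S // uS // xS // addr0 subrr.
have rE : b - A *m x = (w - A *m u) + A *m z.
  rewrite /b /z mulmxBr mulmxDr; move: (A *m x0) (A *m u) (A *m x) => p q r.
  by apply/matrixP => i j; rewrite !mxE; ring.
have zon i : i \in S -> `|dot (a i) (A *m z)| <= gamma.
  move=> iS; have sub := min_on_subgradient g0 xS xmin iS.
  have := sub (x i 0 + 1); have := sub (x i 0 - 1).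
  rewrite rE dotDr won // add0r.
  have := ler_normD (x i 0) 1; have := ler_normB (x i 0) 1; rewrite normr1.
  move=> h1 h2 h3 h4; rewrite ler_norml.
  have k1 : gamma * (`|x i 0 - 1| - `|x i 0|) <= gamma * 1 by rewrite ler_pM2l //; lra.
  have k2 : gamma * (`|x i 0 + 1| - `|x i 0|) <= gamma * 1 by rewrite ler_pM2l //; lra.
  by apply/andP; split; move: h3 h4; set g := dot _ _; lra.
have zsup := gram_sup A_unit S_small zS (ltW g0) zon.
exists x.
  apply: dual_certificate => // i iS; rewrite rE dotDr.
  apply: le_lt_trans (ler_normD _ _) _.
  by have := woff i iS; have := gram_off A_unit S_small zS g0 iS zsup; lra.
have -> : x0 - x = z - u by rewrite /z addrAC addrK.
rewrite l2norm_sqr; apply: dot_triangle => //.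
- by rewrite mulr_ge0 // ltW.
- by rewrite mulr_ge0 // ?divr_ge0 // ltW.
- by apply: dot_le_sup => //; rewrite mulr_ge0 // ?divr_ge0 // ltW.
apply: le_trans (gram_sqr A_unit S_small uS) _.
rewrite exprMn sqr_sqrtr //; lra.
Qed.

End recovery.

(** * Stability of the minimiser *)

Section stability.
Context {R : realType} {n m : nat}.
Variables (A : 'M[R]_(n, m)) (b : 'cV[R]_n) (gamma : R).
Hypothesis gamma_gt0 : 0 < gamma.
Local Notation obj := (bpdn_objective A b gamma).
Implicit Types x y v h : 'cV[R]_m.

Lemma obj_convex x y (t : R) : 0 <= t -> t <= 1 ->
  obj (x + t *: (y - x)) <= obj x + t * (obj y - obj x).
Proof.
move=> t0 t1.
have yE : y = x + (y - x) by rewrite addrC subrK.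
move: (y - x) yE => h ->; rewrite !obj_shift lerD2l [X in _ <= t * X]addrAC subrr add0r.
have hx : l1norm (x + t *: h) - l1norm x <= t * (l1norm (x + h) - l1norm x).
  rewrite /l1norm -!sumrB mulr_sumr; apply: ler_sum => i _.
  rewrite !mxE.
  have -> : x i 0 + t * h i 0 = (1 - t) * x i 0 + t * (x i 0 + h i 0) by ring.
  have t1' : 0 <= 1 - t by rewrite subr_ge0.
  have := ler_normD ((1 - t) * x i 0) (t * (x i 0 + h i 0)).
  rewrite !normrM (ger0_norm t1') (ger0_norm t0); lra.
rewrite -scalemxAr !dotZl !dotZr.
have := ler_wpM2l (ltW gamma_gt0) hx.
have := dot_ge0 (A *m h); set d := dot _ _; set e := dot _ _ => d0 hx'.
have : t * (t * d) <= t * d by rewrite ler_wpM2l // ler_piMl.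
lra.
Qed.

(** On each face of the cube of radius e around x the objective attains a minimum above its
value at x, and there are finitely many faces. By convexity a point outside the cube is at
least as bad as the point where the segment from x to it leaves the cube. *)
Lemma unique_min_gap x (e : R) : unique (bpdn_solution A b gamma) x -> 0 < e ->
  exists2 delta : R, 0 < delta &
    forall y, obj y <= obj x + delta -> forall i, `|y i 0 - x i 0| <= e.
Proof.
move=> [xmin xuniq] e0.
have face (p : 'I_m * bool) : exists2 delta : R, 0 < delta &
    forall v, (forall i, `|v i 0 - x i 0| <= e) ->
      v p.1 0 - x p.1 0 = (-1) ^+ p.2 * e -> obj x + delta <= obj v.
  case: p => j s.
  pose c := x j 0 + (-1) ^+ s * e.
  have [|v vb vmin] := obj_box_min A b gamma
      (lo := fun i => if i == j then c else x i 0 - e)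
      (hi := fun i => if i == j then c else x i 0 + e).
    by move=> i; case: (i == j) => //; lra.
  exists (obj v - obj x); last first.
    move=> y ye yj; rewrite addrC subrK; apply: vmin => i.
    have [->|_] := eqVneq i j; first by rewrite /c -yj addrC subrK lexx.
    by rewrite -ler_distl.
  rewrite subr_gt0 lt_neqAle xmin andbT; apply/eqP => objxv.
  have : x = v by apply: xuniq => y; rewrite -objxv; exact: xmin.
  move=> xv; have := vb j; rewrite eqxx -eq_le -xv /c.
  rewrite -subr_eq0 addrAC subrr add0r.
  by rewrite mulf_eq0 signr_eq0 /= gt_eqF.
have [delta /all_and2 [delta0 Hdelta]] := choice (fun p => let: ex_intro2 d d0 H := face p in
  ex_intro (fun d => 0 < d /\ forall v, (forall i, `|v i 0 - x i 0| <= e) ->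
      v p.1 0 - x p.1 0 = (-1) ^+ p.2 * e -> obj x + d <= obj v) d (conj d0 H)).
pose D := \big[Num.min/1]_p delta p.
have D0 : 0 < D by apply: lt_bigmin => // p _; exact: delta0.
exists (D / 2); first by rewrite divr_gt0.
move=> y yx i; rewrite leNgt; apply/negP => yi.
have [j _ jmax] := @arg_maxP _ _ _ i predT (fun i => `|y i 0 - x i 0|) erefl.
set M := `|y j 0 - x j 0| in jmax *.
have eM : e < M by apply: lt_le_trans yi _; exact: jmax.
have M0 : 0 < M by exact: lt_trans eM.
pose t := e / M.
have t0 : 0 <= t by rewrite divr_ge0 // ltW.
have t1 : t <= 1 by rewrite ler_pdivrMr // mul1r ltW.
pose v := x + t *: (y - x).
have vx k : v k 0 - x k 0 = t * (y k 0 - x k 0) by rewrite !mxE addrAC subrr add0r.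
have ve k : `|v k 0 - x k 0| <= e.
  rewrite vx normrM (ger0_norm t0) /t mulrAC ler_pdivrMr // ler_wpM2l ?(ltW e0) //.
  exact: jmax.
have : obj x + delta (j, y j 0 - x j 0 < 0) <= obj v.
  apply: Hdelta => //=; rewrite vx {1}[y j 0 - x j 0]realEsign ?num_real //.
  by rewrite -/M mulrCA divfK // gt_eqF.
have := obj_convex x y t0 t1; rewrite -/v.
have : D <= delta (j, y j 0 - x j 0 < 0) by exact: bigmin_le.
have : t * (obj y - obj x) <= obj y - obj x by rewrite ler_piMl // subr_ge0 xmin.
lra.
Qed.

(** Density of the rationals and continuity of the objective. *)
Lemma rational_approx v (e : R) : 0 < e ->
  exists2 p : 'cV[rat]_m, (forall i, `|ratr (p i 0) - v i 0| <= e) &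
    obj (map_mx ratr p) <= obj v + e.
Proof.
move=> e0.
have /cvgrPdist_le/(_ e e0) := @obj_continuous R n m A b gamma v^T.
rewrite near_simpl => /nbhs_ballP[r /= r0 ballr].
pose q := Num.min r e.
have q0 : 0 < q by rewrite lt_min r0.
have rats i : exists p : rat, `|ratr p - v i 0| < q.
  have [|p] := @rat_in_itvoo R (v i 0 - q) (v i 0 + q); first lra.
  by rewrite in_itv /= -ltr_distl => pq; exists p.
have [f Hf] := choice rats.
exists (\col_i f i).
  by move=> i; rewrite mxE ltW // (lt_le_trans (Hf i)) // ge_min lexx orbT.
have hb : ball v^T r (map_mx ratr (\col_i f i))^T.
  split=> // i j; rewrite !mxE /ball /= distrC ?ord1.
  by apply: lt_le_trans (Hf j) _; rewrite ge_min lexx.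
have := ballr _ hb; rewrite /= !trmxK ler_distl; lra.
Qed.

End stability.

(** * Rational characterisation of unique recovery *)

Lemma dot_perturb (R : realType) (m : nat) (v h : 'cV[R]_m) (e : R) :
  0 <= e -> e <= 1 -> (forall i, `|h i 0| <= e) ->
  `|dot (v + h) (v + h) - dot v v| <= (2 * l1norm v + m%:R) * e.
Proof.
move=> e0 e1 he.
have -> : dot (v + h) (v + h) - dot v v = 2 * dot v h + dot h h.
  by rewrite !(dotDl, dotDr) (dotC h v); ring.
apply: le_trans (ler_normD _ _) _; rewrite [leRHS]mulrDl; apply: lerD.
  rewrite normrM ger0_norm // -mulrA ler_pM2l // dotE /l1norm mulr_suml.
  apply: le_trans (ler_norm_sum _ _ _) _; apply: ler_sum => i _.
  by rewrite normrM ler_wpM2l.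
rewrite ger0_norm ?dot_ge0 // dotE.
have -> : m%:R * e = \sum_(i < m) e by rewrite sumr_const card_ord mulr_natl.
apply: ler_sum => i _; rewrite -expr2 -real_normK ?num_real // expr2.
apply: (@le_trans _ _ (1 * `|h i 0|)); last by rewrite mul1r.
by rewrite ler_wpM2r //; exact: le_trans e1.
Qed.

Lemma le_of_invS (R : realType) (a b c : R) : 0 <= c ->
  (forall k : nat, a <= b + c * k.+1%:R^-1) -> a <= b.
Proof.
move=> c0 h; rewrite leNgt; apply/negP => ba.
have c1 : 0 < c + 1 by lra.
have d0 : 0 < (a - b) / (c + 1) by rewrite divr_gt0 // subr_gt0.
have [k] := ltr_add_invr d0; rewrite add0r => hk.
have k0 : 0 <= k.+1%:R^-1 :> R by rewrite invr_ge0.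
move: hk; rewrite ltr_pdivlMr // => hk.
have := h k; move: ba hk k0; set u := _^-1; nra.
Qed.

Section characterisation.
Context {R : realType} {n m : nat}.
Variables (A : 'M[R]_(n, m)) (gamma : R).
Hypothesis gamma_gt0 : 0 < gamma.

(** Only rational competitors are compared, so that for a random [b] this is a countable
intersection of measurable events. *)
Definition near_min (b : 'cV[R]_n) (l : nat) (p : 'cV[rat]_m) : Prop :=
  forall r : 'cV[rat]_m, bpdn_objective A b gamma (map_mx ratr p) <=
    bpdn_objective A b gamma (map_mx ratr r) + l.+1%:R^-1.

(** If the minimiser is unique, [unique_min_gap] brings all near minimisers close to it.
Conversely every minimiser is a limit of rational near minimisers, so that any two of them
are arbitrarily close to each other. *)
Lemma unique_solution_rational (b : 'cV[R]_n) (x0 : 'cV[R]_m) (C : R) :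
  (exists2 x, unique (bpdn_solution A b gamma) x & l2norm (x0 - x) ^+ 2 <= C) <->
  (forall k : nat, exists l : nat, forall p q, near_min b l p -> near_min b l q ->
     (forall i, `|ratr (p i 0) - ratr (q i 0)| <= k.+1%:R^-1 :> R) /\
     l2norm (x0 - map_mx ratr p) ^+ 2 <= C + k.+1%:R^-1).
Proof.
have eps0 (k : nat) : 0 < k.+1%:R^-1 :> R by rewrite invr_gt0.
have eps1 (k : nat) : k.+1%:R^-1 <= 1 :> R by rewrite invf_le1 // ler1n.
split.
- move=> [x xuniq xC] k; move: (eps0 k) (eps1 k); move: (k.+1%:R^-1) => e e0 e1.
  pose K := 2 * l1norm (x0 - x) + m%:R + 2.
  have l10 : 0 <= l1norm (x0 - x) by apply: sumr_ge0.
  have m0 : 0 <= m%:R :> R by [].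
  have K2 : 2 <= K by rewrite /K; lra.
  have K0 : 0 < K by lra.
  (* if p is within eta <= 1 of x in each entry, then |x0 - p|^2 and |x0 - x|^2 differ by
     at most K * eta *)
  pose eta := e / K.
  have eta0 : 0 < eta by rewrite divr_gt0.
  have etaK : eta * K = e by rewrite divfK // gt_eqF.
  have eta1 : eta <= 1.
    rewrite ler_pdivrMr // mul1r (le_trans e1) //; lra.
  have [delta delta0 gap] := unique_min_gap gamma_gt0 xuniq eta0.
  have d20 : 0 < delta / 2 by rewrite divr_gt0.
  have [l] := ltr_add_invr d20; rewrite add0r => ld.
  have [r _ rx] := rational_approx A b gamma x d20.
  exists l => p q hp hq.
  have near_x s : near_min b l s -> forall i, `|ratr (s i 0) - x i 0| <= eta.
    move=> hs i; have := gap (map_mx ratr s) _ i; rewrite mxE; apply.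
    move: ld (hs r) rx; move: (l.+1%:R^-1) => u; lra.
  split=> [i|].
    have := near_x p hp i; have := near_x q hq i.
    have := ler_distD (x i 0) (ratr (p i 0)) (ratr (q i 0) : R).
    rewrite [`|x i 0 - _|]distrC.
    have : eta * 2 <= eta * K by rewrite ler_pM2l.
    rewrite etaK; lra.
  have hi i : `|(x - map_mx ratr p) i 0| <= eta.
    by have := near_x p hp i; rewrite distrC !mxE.
  have := dot_perturb (x0 - x) (ltW eta0) eta1 hi.
  rewrite addrA subrK -!l2norm_sqr => /ler_normlW.
  have -> : 2 * l1norm (x0 - x) + m%:R = K - 2 by rewrite /K addrK.
  rewrite mulrBl [K * eta]mulrC etaK; lra.
- move=> H.
  have [x _ xmin0] := obj_min_on A b gamma_gt0 [set: 'I_m]%SET.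
  have xmin : bpdn_solution A b gamma x.
    by move=> y; apply: xmin0 => i; rewrite inE.
  have approx k l y : bpdn_solution A b gamma y -> exists2 p : 'cV[rat]_m,
      near_min b l p & forall i, `|ratr (p i 0) - y i 0| <= k.+1%:R^-1.
    move=> ymin; pose e := Num.min (k.+1%:R^-1 : R) l.+1%:R^-1.
    have e0 : 0 < e by rewrite lt_min !eps0.
    have [p pe py] := rational_approx A b gamma y e0.
    exists p => [r|i].
      apply: le_trans py _; apply: lerD; first exact: ymin.
      by rewrite ge_min lexx orbT.
    by apply: le_trans (pe i) _; rewrite ge_min lexx.
  exists x.
    split=> // y ymin; apply/matrixP => i j; rewrite ord1.
    apply/eqP; rewrite -subr_eq0 -normr_le0.
    apply: (@le_of_invS _ _ _ 3) => // k; rewrite add0r.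
    have [l Hl] := H k.
    have [p hp px] := approx k l x xmin.
    have [q hq qy] := approx k l y ymin.
    have [/(_ i) h _] := Hl p q hp hq.
    have := px i; have := qy i.
    have := ler_distD (ratr (p i 0)) (x i 0) (y i 0).
    have := ler_distD (ratr (q i 0)) (ratr (p i 0)) (y i 0).
    rewrite (distrC (x i 0) (ratr _)); move: (h); move: (k.+1%:R^-1) => u; lra.
  pose K := 2 * l1norm (x0 - x) + m%:R.
  apply: (@le_of_invS _ _ _ (K + 1)).
    by rewrite addr_ge0 // addr_ge0 // mulr_ge0 //; apply: sumr_ge0.
  move=> k; have [l Hl] := H k.
  have [p hp px] := approx k l x xmin.
  have [_] := Hl p p hp hp.
  have hi i : `|(x - map_mx ratr p) i 0| <= k.+1%:R^-1.
    by have := px i; rewrite distrC !mxE.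
  have := dot_perturb (x0 - x) (ltW (eps0 k)) (eps1 k) hi.
  rewrite addrA subrK -!l2norm_sqr -/K ler_norml => /andP[].
  move: (k.+1%:R^-1) => u; lra.
Qed.

End characterisation.

(** * Measurability and oracle least squares *)

Lemma measurable_forall (d : measure_display) (T : measurableType d) (I : countType)
    (F : I -> set T) :
  (forall i, measurable (F i)) -> measurable [set t | forall i, F i t].
Proof.
move=> mF.
have -> : [set t | forall i, F i t] = ~` \bigcup_i ~` F i.
  rewrite setC_bigcup; apply/seteqP; split => t h i; first by rewrite setCK.
  by have := h i Logic.I; rewrite setCK.
apply: measurableC; apply: countable_bigcupT_measurable => // i.
exact: measurableC.
Qed.

Lemma measurable_exists (d : measure_display) (T : measurableType d) (I : countType)
    (F : I -> set T) :
  (forall i, measurable (F i)) -> measurable [set t | exists i, F i t].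
Proof.
move=> mF.
have -> : [set t | exists i, F i t] = \bigcup_i F i.
  by apply/seteqP; split => t [i]; [exists i|move=> _; exists i].
exact: countable_bigcupT_measurable.
Qed.

Lemma measurable_imply (d : measure_display) (T : measurableType d) (F G : set T) :
  measurable F -> measurable G -> measurable [set t | F t -> G t].
Proof.
move=> mF mG; rewrite (_ : [set t | F t -> G t] = ~` F `|` G).
  by apply: measurableU => //; exact: measurableC.
apply/seteqP; split => t /=; last by case.
by have [Ft /(_ Ft)|nF _] := pselect (F t); [right|left].
Qed.

Lemma measurable_const (d : measure_display) (T : measurableType d) (Q : Prop) :
  measurable [set _ : T | Q].
Proof.
have [q|nq] := pselect Q.
  by rewrite (_ : [set _ | Q] = setT); [exact: measurableT|apply/seteqP; split].
by rewrite (_ : [set _ | Q] = set0); [exact: measurable0|apply/seteqP; split].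
Qed.

Lemma measurable_unique_solution (R : realType) (n m : nat) (A : 'M[R]_(n, m))
    (gamma : R) (d : measure_display) (T : measurableType d) (b : T -> 'cV[R]_n)
    (x0 : 'cV[R]_m) (C : R) :
  0 < gamma -> (forall k, measurable_fun setT (fun t => b t k 0)) ->
  measurable [set t | exists2 x, unique (bpdn_solution A (b t) gamma) x &
                        l2norm (x0 - x) ^+ 2 <= C].
Proof.
move=> g0 mb.
have mobj (x : 'cV[R]_m) : measurable_fun setT (fun t => bpdn_objective A (b t) gamma x).
  rewrite (_ : (fun t => _) = (fun t => 2^-1 * (\sum_(k < n) (b t k 0 - (A *m x) k 0) ^+ 2)
      + gamma * l1norm x)); last first.
    apply/funext => t; rewrite objE dotE; congr (_ * _ + _).
    by apply: eq_bigr => k _; rewrite !mxE expr2.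
  apply: measurable_funD => //; apply: measurable_funM => //.
  apply: (@measurable_sum _ _ _ _ _ _ (fun k t => (b t k 0 - (A *m x) k 0) ^+ 2)) => k.
  apply: measurable_funX; exact: measurable_funB.
have mnear l p : measurable [set t | near_min A gamma (b t) l p].
  apply: (@measurable_forall _ _ _ (fun r => [set t | _])) => r.
  have mr : measurable_fun setT
      (fun t => bpdn_objective A (b t) gamma (map_mx ratr r) + l.+1%:R^-1).
    exact: measurable_funD.
  rewrite -[X in measurable X]setTI.
  by apply: (measurable_fun_ler (mobj _) mr measurableT (Y := [set true])).
rewrite (_ : [set t | _] = [set t | forall k : nat, exists l : nat,
    forall p q, near_min A gamma (b t) l p -> near_min A gamma (b t) l q ->
     (forall i, `|ratr (p i 0) - ratr (q i 0)| <= k.+1%:R^-1 :> R) /\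
     l2norm (x0 - map_mx ratr p) ^+ 2 <= C + k.+1%:R^-1]); last first.
  by apply/seteqP; split => t /= /(unique_solution_rational A g0).
apply: (@measurable_forall _ _ _ (fun k => [set t | _])) => k.
apply: (@measurable_exists _ _ _ (fun l => [set t | _])) => l.
apply: (@measurable_forall _ _ _ (fun p => [set t | _])) => p.
apply: (@measurable_forall _ _ _ (fun q => [set t | _])) => q.
apply: (measurable_imply (mnear l p)); apply: (measurable_imply (mnear l q)).
exact: measurable_const.
Qed.

Section oracle.
Context {R : realType} {n m : nat}.
Variables (A : 'M[R]_(n, m)) (S : {set 'I_m}).
Local Notation a := (fun i => col i A).
Hypothesis A_unit : forall i, dot (a i) (a i) = 1.
Hypothesis S_small : 3 * (#|S|%:R * coherence A) < 1.
Implicit Types v : 'cV[R]_n.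

(** The Gram matrix of the columns in [S], completed by the identity off [S]. This keeps the
index type and makes the solutions of the normal equations supported by [S]. *)
Definition gram_on : 'M[R]_m :=
  \matrix_(i, j) if (i \in S) && (j \in S) then dot (a i) (a j) else (i == j)%:R.

Lemma gram_on_unit : gram_on \in unitmx.
Proof.
rewrite unitmxE unitfE; apply/negP => /det0P[v v0 vG].
have vE j : \sum_i v 0 i * gram_on i j = 0.
  by have /matrixP/(_ 0 j) := vG; rewrite !mxE.
have zS : supported S v^T.
  move=> j jS; rewrite mxE -[RHS](vE j) (bigD1 j) //= mxE (negbTE jS) andbF eqxx mulr1.
  rewrite big1 ?addr0 // => i /negbTE ij.
  by rewrite mxE (negbTE jS) andbF ij mulr0.
have zon j : j \in S -> `|dot (a j) (A *m v^T)| <= 0.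
  move=> jS; rewrite normr_le0; apply/eqP; rewrite -[RHS](vE j) dotC dot_mulmxl.
  apply: eq_bigr => i _; rewrite [v^T i 0]mxE mxE jS andbT.
  by have [//|iS] := boolP (i \in S); have := zS i iS; rewrite mxE => ->; rewrite !mul0r.
have z0 := gram_sup A_unit S_small zS (lexx 0) zon.
move/eqP: v0; apply; apply/matrixP => i j; rewrite ord1 !mxE.
by have := z0 j; rewrite mulr0 normr_le0 mxE => /eqP.
Qed.

Definition correlations v : 'cV[R]_m := \col_i if i \in S then dot (a i) v else 0.

(** The least squares fit by a vector supported by [S]. *)
Definition oracle v : 'cV[R]_m := invmx gram_on *m correlations v.

Lemma gram_on_oracle v : gram_on *m oracle v = correlations v.
Proof. by rewrite /oracle mulKVmx // gram_on_unit. Qed.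

Lemma oracle_supported v : supported S (oracle v).
Proof.
move=> i iS; have /matrixP/(_ i 0) := gram_on_oracle v.
rewrite [LHS]mxE [RHS]mxE (negbTE iS) (bigD1 i) //= big1 => [|j /negbTE ji].
  by rewrite addr0 mxE (negbTE iS) /= eqxx mul1r.
by rewrite mxE (negbTE iS) /= eq_sym ji mul0r.
Qed.

Lemma oracle_normal v i : i \in S -> dot (a i) (v - A *m oracle v) = 0.
Proof.
move=> iS; rewrite dotBr; apply/eqP; rewrite subr_eq0; apply/eqP.
have /matrixP/(_ i 0) := gram_on_oracle v; rewrite [RHS]mxE iS => <-.
rewrite mxE [RHS]dotC dot_mulmxl; apply: eq_bigr => j _.
rewrite mxE iS /=; have [jS|jS] := boolP (j \in S); first by rewrite mulrC dotC.
by rewrite oracle_supported // mulr0 mul0r.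
Qed.

Lemma dot_mulmx_supported z v : supported S z -> (forall i, i \in S -> dot (a i) v = 0) ->
  dot (A *m z) v = 0.
Proof.
move=> zS v0; rewrite dot_mulmxl big1 // => i _.
by have [/v0 ->|/zS ->] := boolP (i \in S); rewrite ?mulr0 ?mul0r.
Qed.

Lemma oracle_orth v u : supported S u -> dot (A *m u) (v - A *m oracle v) = 0.
Proof. by move=> uS; apply: dot_mulmx_supported => // i; exact: oracle_normal. Qed.

Lemma oracle_pythagoras v :
  dot v v = dot (A *m oracle v) (A *m oracle v) +
            dot (v - A *m oracle v) (v - A *m oracle v).
Proof.
have := oracle_orth v (oracle_supported v).
move: (A *m oracle v) => p; rewrite !(dotBl, dotBr) (dotC v p) => h; lra.
Qed.

(** The component of column [i] orthogonal to the columns in [S]. *)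
Definition residual i := a i - A *m oracle (a i).

(** The orthogonal projection is self-adjoint. *)
Lemma residualE i v : dot (a i) (v - A *m oracle v) = dot (residual i) v.
Proof.
transitivity (dot (residual i) (v - A *m oracle v)).
  by rewrite dotBl (oracle_orth v (oracle_supported _)) subr0.
rewrite dotBr (dotC _ (A *m oracle v)) (oracle_orth _ (oracle_supported _)) subr0 //.
Qed.

Lemma residual_le1 i : dot (residual i) (residual i) <= 1.
Proof. by rewrite -(A_unit i) [leRHS](oracle_pythagoras (a i)) lerDr dot_ge0. Qed.

Lemma residual_orth i j : j \in S -> dot (a j) (residual i) = 0.
Proof. exact: oracle_normal. Qed.

End oracle.

(** * Tails of the two noise components *)

Section events.
Context {R : realType} {n m : nat} {d : measure_display} {T : measurableType d}.
Variables (A : 'M[R]_(n, m)) (S : {set 'I_m}) (P : probability T R) (sigma : R).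
Variable (w : 'I_n -> T -> R).
Local Notation a := (fun i => col i A).
Hypothesis A_unit : forall i, dot (a i) (a i) = 1.
Hypothesis S_small : 3 * (#|S|%:R * coherence A) < 1.
Hypothesis sigma_gt0 : 0 < sigma.
Hypothesis ww : white P sigma w.

Definition noise t : 'cV[R]_n := \col_i w i t.
(** The square norm of the projection of the noise on the span of the columns in [S]. *)
Definition energy t : R :=
  dot (A *m oracle A S (noise t)) (A *m oracle A S (noise t)).

Let mw i : measurable_fun setT (w i). Proof. by case: ww. Qed.
Let sn0 : sigma != 0. Proof. by rewrite gt_eqF. Qed.

Lemma measurable_dot_noise (v : 'cV[R]_n) : measurable_fun setT (fun t => dot v (noise t)).
Proof.
rewrite (_ : (fun t => _) = (fun t => \sum_i v i 0 * w i t)).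
  apply: (@measurable_sum _ _ _ _ _ _ (fun i t => v i 0 * w i t)) => i.
  exact: measurable_funM.
by apply/funext => t; rewrite dotE; apply: eq_bigr => i _; rewrite mxE.
Qed.

Lemma energyE t : energy t = \sum_(i < n)
  (\sum_(j < m) (A *m invmx (gram_on A S)) i j *
      (if j \in S then dot (a j) (noise t) else 0)) ^+ 2.
Proof.
rewrite /energy dotE; apply: eq_bigr => i _; rewrite -expr2 /oracle mulmxA [in LHS]mxE.
by congr (_ ^+ 2); apply: eq_bigr => j _; rewrite [in LHS]/correlations [X in _ * X]mxE.
Qed.

Lemma measurable_energy : measurable_fun setT energy.
Proof.
rewrite (funext energyE).
apply: (@measurable_sum _ _ _ _ _ _ (fun i t => (\sum_(j < m) (A *m invmx (gram_on A S)) i j *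
      (if j \in S then dot (a j) (noise t) else 0)) ^+ 2)) => i.
apply: measurable_funX.
apply: (@measurable_sum _ _ _ _ _ _ (fun j t => (A *m invmx (gram_on A S)) i j *
      (if j \in S then dot (a j) (noise t) else 0))) => j.
apply: measurable_funM => //; case: (j \in S) => //.
exact: measurable_dot_noise.
Qed.

(** After a rotation that moves the residual column onto one axis, the columns in [S], being
orthogonal to it, have no component along this axis. The two events then depend on disjoint
sets of coordinates of white noise. *)
Lemma residual_tail (i : 'I_m) (tau c : R) : 0 <= tau ->
  (P ([set t | (tau < `|dot (residual A S i) (noise t)|)%R] `&` [set t | (energy t <= c)%R]) <=
   (expR (- (tau ^+ 2 / (2 * sigma ^+ 2))))%:E * P [set t | (energy t <= c)%R])%E.
Proof.
move=> tau0; set r := residual A S i.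
have [r0|r0] := eqVneq r 0.
  rewrite (_ : _ `&` _ = set0) ?measure0 ?mule_ge0 // ?lee_fin ?expR_ge0 //.
  apply/seteqP; split => t //= -[]; rewrite r0 -(scale0r (0 : 'cV[R]_n)) dotZl mul0r normr0.
  by rewrite ltNge tau0.
have [k _] : exists k : 'I_n, r k 0 != 0.
  apply/existsP; rewrite -negb_forall; apply: contra r0 => /forallP h.
  by apply/eqP/matrixP => x y; rewrite ord1 [RHS]mxE; apply/eqP/h.
pose l := [seq x <- enum 'I_n | x != k].
have ul : uniq (k :: l) by rewrite /= mem_filter eqxx /= filter_uniq // enum_uniq.
have [Q [[Qiso Qw] _ _ Qr]] := white_isometry_clear P sn0 r ul.
have Qr0 x : x != k -> (Q *m r) x 0 = 0.
  by move=> xk; apply: Qr; rewrite mem_filter xk mem_enum.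
pose w' := mix Q w.
have w'w : white P sigma w' by exact: Qw.
have dotQ v t : dot v (noise t) = \sum_x (Q *m v) x 0 * w' x t.
  by rewrite -Qiso dotE; apply: eq_bigr => x _; rewrite /w' /mix.
pose rho := (Q *m r) k 0.
have dotr t : dot r (noise t) = rho * w' k t.
  by rewrite dotQ (bigD1 k) //= big1 ?addr0 // => x xk; rewrite Qr0 ?mul0r.
have rho2 : rho ^+ 2 = dot r r.
  by rewrite -Qiso dotE (bigD1 k) //= big1 ?addr0 // => x xk; rewrite Qr0 ?mul0r.
have rho0 : rho != 0 by rewrite -sqrf_eq0 rho2 dot_eq0.
have rho1 : `|rho| <= 1.
  rewrite -ler_sqr ?nnegrE // expr1n real_normK ?num_real // rho2.
  exact: residual_le1.
have Qa0 j : j \in S -> (Q *m a j) k 0 = 0.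
  move=> jS; apply: (mulIf rho0); rewrite mul0r -(residual_orth A_unit S_small i jS) -Qiso.
  by rewrite dotE (bigD1 k) //= big1 ?addr0 // => x xk; rewrite Qr0 ?mulr0.
have av : avoids w' k energy.
  have -> : energy = fun t => \sum_(i < n)
      (\sum_(j < m) (A *m invmx (gram_on A S)) i j *
        (if j \in S then \sum_x (if x == k then 0 else (Q *m a j) x 0 * w' x t) else 0)) ^+ 2.
    apply/funext => t; rewrite energyE; apply: eq_bigr => x _; congr (_ ^+ 2).
    apply: eq_bigr => j _; case: ifP => // jS; rewrite dotQ; congr (_ * _).
    by apply: eq_bigr => y _; case: eqP => // ->; rewrite Qa0 // mul0r.
  apply: (avoids_sum _ (f := fun x t => (\sum_(j < m) _) ^+ 2)) => x; apply: avoidsX.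
  apply: (avoids_sum _ (f := fun j t => _ * (if j \in S then _ else 0))) => j.
  apply: avoidsM; first exact: avoids_cst.
  case: (j \in S); last exact: avoids_cst.
  apply: (avoids_sum _ (f := fun x t => if x == k then 0 else _)) => y.
  have [_|yk] := eqVneq y k; first exact: avoids_cst.
  by apply: avoidsM; [exact: avoids_cst|exact: avoids_coord].
have mC : measurable [set x : R | x <= c] by rewrite -set_itvNyc.
apply: le_trans (white_tail_indep w'w sigma_gt0 tau0 mC av).
have mE : measurable (energy @^-1` [set x : R | x <= c]).
  by rewrite -[X in measurable X]setTI; exact: measurable_energy.
have mgt (f : T -> R) : measurable_fun setT f -> measurable [set t | tau < `|f t|].
  move=> mf; rewrite -[X in measurable X]setTI.
  have mf' : measurable_fun setT (fun t => `|f t|) by exact: measurableT_comp.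
  by apply: (measurable_fun_ltr (measurable_cst tau) mf' measurableT (Y := [set true])).
apply: le_measure; rewrite ?inE.
- by apply: measurableI => //; apply: mgt; exact: measurable_dot_noise.
- by apply: measurableI => //; apply: mgt; case: w'w.
move=> t /= [h1 h2]; split => //; apply: lt_le_trans h1 _.
by rewrite dotr normrM ler_piMl.
Qed.

(** After triangularisation the columns in [S] vanish beyond the first #|S| coordinates, so
the projection of the noise is no longer than the vector of its first #|S| coordinates. *)
Lemma energy_tail :
  (P [set t | (2 * #|S|%:R * sigma ^+ 2 < energy t)%R] <=
   ((expR (- 2^-1) * Num.sqrt 2) ^+ #|S|)%:E)%E.
Proof.
have [Q [Qiso Qw] Qs] := white_isometry_triangular P sn0 [seq a j | j <- enum S].
rewrite size_map -cardE in Qs.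
pose w' := mix Q w.
have w'w : white P sigma w' by exact: Qw.
pose l := [seq x : 'I_n <- enum 'I_n | (x < #|S|)%N].
have ul : uniq l by rewrite filter_uniq // enum_uniq.
have sl : (size l <= #|S|)%N.
  rewrite -(size_map val) -(size_iota 0 #|S|); apply: uniq_leq_size.
    by rewrite map_inj_uniq //; exact: val_inj.
  by move=> x /mapP[y]; rewrite mem_filter mem_iota => /andP[yS _] ->.
pose X t := \sum_(x <- l) w' x t ^+ 2.
have X0 t : 0 <= X t by apply: sumr_ge0 => x _; exact: sqr_ge0.
have eX t : energy t <= X t.
  pose p := A *m oracle A S (noise t).
  have Qp (x : 'I_n) : (#|S| <= x)%N -> (Q *m p) x 0 = 0.
    move=> xS; rewrite /p mulmxA mxE big1 // => j _.
    have [jS|jS] := boolP (j \in S); last first.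
      by rewrite (oracle_supported A_unit S_small) // mulr0.
    have -> : (Q *m A) x j = (Q *m a j) x 0.
      by rewrite !mxE; apply: eq_bigr => y _; rewrite mxE.
    rewrite (Qs (a j) _ x xS) ?mul0r //.
    by apply: (map_f (fun j => a j)); rewrite mem_enum.
  pose y : 'cV[R]_n := \col_x if (x < #|S|)%N then w' x t else 0.
  have yy : dot y y = X t.
    rewrite dotE /X /l big_filter big_enum_cond /= [RHS]big_mkcond.
    by apply: eq_bigr => x _; rewrite !mxE; case: ifP => _; rewrite ?mulr0 ?expr2.
  have pE : energy t = dot (Q *m p) y.
    have := oracle_orth A_unit S_small (noise t) (oracle_supported A_unit S_small (noise t)).
    rewrite dotBr -/p => /eqP; rewrite subr_eq0 => /eqP e.
    rewrite /energy -/p -e -Qiso !dotE; apply: eq_bigr => x _.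
    rewrite [y x 0]mxE; case: ltnP => [_|xS]; first by [].
    by rewrite Qp // !mul0r.
  have := CauchySchwarz_dot (Q *m p) y; rewrite -pE Qiso yy -/(energy t).
  have e0 : 0 <= energy t by exact: dot_ge0.
  have [->|en0] := eqVneq (energy t) 0; first by rewrite X0.
  by rewrite expr2 ler_pM2l // lt_def en0.
apply: (@le_trans _ _ (P [set t | (2 * #|S|%:R * sigma ^+ 2 < X t)%R])).
  have mlt (f : T -> R) : measurable_fun setT f ->
      measurable [set t | 2 * #|S|%:R * sigma ^+ 2 < f t].
    move=> mf; rewrite -[X in measurable X]setTI.
    by apply: (measurable_fun_ltr (measurable_cst _) mf measurableT (Y := [set true])).
  apply: le_measure; rewrite ?inE.
  - by apply: mlt; exact: measurable_energy.
  - apply: mlt; apply: measurable_sum => x; apply: measurable_funX; by case: w'w.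
  by move=> t /= h; exact: lt_le_trans h _.
apply: le_trans (chi_square_tail w'w _ sigma_gt0 ul) _.
rewrite lee_fin exprMn -expRM_natl.
have -> : - (4 * sigma ^+ 2)^-1 * (2 * #|S|%:R * sigma ^+ 2) = #|S|%:R * - 2^-1.
  by field.
rewrite ler_wpM2l ?expR_ge0 //.
have s21 : 1 <= Num.sqrt 2 :> R by rewrite -[leLHS]sqrtr1 ler_wsqrtr // ler1n.
exact: ler_weXn2l.
Qed.

End events.

(** * Probability of recovery *)

(** Equivalently 2^7 < e^5, where e is bounded from below by (1 + 1/20)^20. *)
Lemma chi_square_constant (R : realType) :
  expR (- 2^-1) * Num.sqrt 2 < expR (- 7^-1) :> R.
Proof.
have e5 : 128 < expR 5 :> R.
  have -> : 5 = 4%:R * (5%:R * (5%:R * 20^-1)) :> R by field.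
  rewrite !expRM_natl.
  have pow_le (x y : R) k : 0 <= x -> x <= y -> x ^+ k <= y ^+ k.
    by move=> x0 xy; rewrite lerXn2r // nnegrE // (le_trans x0).
  have h1 : 1276 / 1000 <= expR 20^-1 ^+ 5 :> R.
    apply: le_trans (pow_le (1 + 20^-1) _ 5 _ (expR_ge1Dx _)); lra.
  have h2 : 338 / 100 <= (expR 20^-1 ^+ 5) ^+ 5 :> R.
    apply: le_trans (pow_le (1276 / 1000) _ 5 _ h1); lra.
  apply: lt_le_trans (pow_le (338 / 100) _ 4 _ h2); lra.
have h2 : 2 < expR (5 / 7) :> R.
  rewrite -(@ltr_pXn2r _ 7) ?nnegrE ?expR_ge0 //.
  rewrite -expRM_natl (_ : 7%:R * (5 / 7) = 5); last by field.
  by apply: le_lt_trans e5; lra.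
rewrite mulrC -ltr_pdivlMr ?expR_gt0 // -expRN opprK -expRD.
rewrite -(@ltr_pXn2r _ 2) ?nnegrE ?expR_ge0 ?sqrtr_ge0 // sqr_sqrtr //.
by rewrite -expRM_natl (_ : 2%:R * (- 7^-1 + 2^-1) = 5 / 7); last by field.
Qed.

Lemma normal_ball_gt0 (R : realType) (sigma e : R) : 0 < sigma -> 0 < e ->
  (0 < normal_prob 0 sigma `[(- e)%R, e]%classic)%E.
Proof.
move=> s0 e0; have sn0 : sigma != 0 by rewrite gt_eqF.
pose c := normal_pdf 0 sigma e.
have c0 : 0 < c by rewrite /c normal_pdfE // mulr_gt0 ?expR_gt0 // normal_peak_gt0.
apply: (@lt_le_trans _ _ (\int[lebesgue_measure]_(x in `[(- e)%R, e]) c%:E)%E).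
  rewrite integral_cst //= lebesgue_measure_itv /= lte_fin gtrN //.
  by rewrite -EFinB -EFinM lte_fin mulr_gt0 //; lra.
apply: ge0_le_integral => //.
- by move=> x _; rewrite lee_fin ltW.
- by apply/measurable_EFinP; apply: measurable_funTS; exact: measurable_normal_pdf.
move=> x /=; rewrite in_itv /= => /andP[x1 x2].
rewrite lee_fin /c !normal_pdfE // ler_wpM2l ?normal_peak_ge0 // ler_expR !subr0.
rewrite !mulNr lerN2 ler_wpM2r ?invr_ge0 ?mulrn_wge0 ?sqr_ge0 //; nra.
Qed.

(** The event is a box, so that its probability is a product of positive factors. *)
Lemma white_ball_gt0 (R : realType) (d : measure_display) (T : measurableType d)
    (P : probability T R) (n : nat) (sigma e : R) (w : 'I_n -> T -> R) :
  0 < sigma -> 0 < e -> white P sigma w -> (0 < P [set t | forall i, (`|w i t| <= e)%R])%E.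
Proof.
move=> s0 e0 [_ Pw].
have := Pw (fun _ => `[- e, e]%classic) (fun _ => measurable_itv _).
rewrite (_ : [set t | _] = [set t | forall i, `|w i t| <= e]); last first.
  by apply/seteqP; split => t /= h i; have := h i; rewrite /= in_itv /= ler_norml.
move=> ->; elim/big_ind : _ => //; first exact: mule_gt0.
by move=> i _; exact: normal_ball_gt0.
Qed.

Lemma union_bound (R : realType) (d : measure_display) (T : measurableType d)
    (P : {measure set T -> \bar R}) (I : Type) (s : seq I) (Q : pred I) (B : I -> set T) :
  (forall i, measurable (B i)) ->
  (P (\big[setU/set0]_(i <- s | Q i) B i) <= \sum_(i <- s | Q i) P (B i))%E.
Proof.
move=> mB; elim: s => [|i s IH]; first by rewrite !big_nil measure0.
rewrite !big_cons; case: ifP => // _.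
apply: le_trans (measureU2 _ (mB i) _) _; first exact: bigsetU_measurable.
exact: leeD.
Qed.

Section main.
Context {R : realType} {n m : nat} {d : measure_display} {T : measurableType d}.
Variables (A : 'M[R]_(n, m)) (x0 : 'cV[R]_m) (P : probability T R) (sigma gamma : R).
Variable (w : 'I_n -> T -> R).
Let S : {set 'I_m} := [set i | x0 i 0 != 0]%SET.
Local Notation a := (fun i => col i A).
Hypothesis A_unit : forall i, dot (a i) (a i) = 1.
Hypothesis S_small : 3 * (#|S|%:R * coherence A) < 1.
Hypothesis sigma_gt0 : 0 < sigma.
Hypothesis gamma_gt0 : 0 < gamma.
Hypothesis ww : white P sigma w.

Definition recovered : set T := [set t |
  exists2 x, unique (bpdn_solution A (A *m x0 + noise w t) gamma) x &
    l2norm (x0 - x) ^+ 2 <= (sigma * Num.sqrt 3 + 3 / 2 * gamma) ^+ 2 * #|S|%:R].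

Let mw i : measurable_fun setT (w i). Proof. by case: ww. Qed.

Lemma measurable_recovered : measurable recovered.
Proof.
apply: measurable_unique_solution => // k.
rewrite (_ : (fun t => _) = (fun t => (A *m x0) k 0 + w k t)).
  by apply: measurable_funD => //.
by apply/funext => t; rewrite !mxE.
Qed.

Lemma x0_supported : supported S x0.
Proof. by move=> i; rewrite inE negbK => /eqP. Qed.

Lemma recovered_of_events t :
  energy A S w t <= 2 * #|S|%:R * sigma ^+ 2 ->
  (forall i, i \notin S -> `|dot (residual A S i) (noise w t)| <= gamma / 2) ->
  recovered t.
Proof.
move=> et rt.
apply: (recovery A_unit S_small sigma_gt0 gamma_gt0 x0_supported
  (oracle_supported A_unit S_small (noise w t))) => // i iS.
  exact: oracle_normal.
by rewrite residualE //; exact: rt.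
Qed.

(** The noise, hence both of its components, can be arbitrarily small. The case of an empty
support is separate, as the bound on the energy is then 0. *)
Lemma recovered_gt0 : (0 < P recovered)%E.
Proof.
pose c := Num.min 1 (Num.min (2 * sigma ^+ 2) ((gamma / 2) ^+ 2)).
have c0 : 0 < c by rewrite !lt_min ltr01 !mulr_gt0 ?exprn_gt0 ?divr_gt0.
have [c1 [c2 c3]] : c <= 1 /\ c <= 2 * sigma ^+ 2 /\ c <= (gamma / 2) ^+ 2.
  by rewrite /c !ge_min !lexx ?orbT.
pose e := c / n.+1%:R.
have e0 : 0 < e by rewrite divr_gt0.
apply: lt_le_trans (white_ball_gt0 sigma_gt0 e0 ww) _.
have mball : measurable [set t | forall i, `|w i t| <= e].
  have := @measurable_box _ _ _ _ w predT (fun _ => `[- e, e]%classic) mw (fun _ => measurable_itv _).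
  congr (measurable _); apply/seteqP; split => t /= h i.
    by have := h i isT; rewrite /= in_itv /= ler_norml.
  by move=> _; rewrite /= in_itv /= -ler_norml.
apply: le_measure; rewrite ?inE //; first exact: measurable_recovered.
move=> t wt.
have wc : dot (noise w t) (noise w t) <= c.
  have e1 : e <= 1 by rewrite ler_pdivrMr // mul1r (le_trans c1) // ler1n.
  have en : n%:R * e <= c.
    rewrite mulrA ler_pdivrMr // mulrC ler_wpM2l //; first exact: ltW.
    by rewrite ler_nat.
  apply: le_trans en; rewrite dotE.
  have -> : n%:R * e = \sum_(i < n) e by rewrite sumr_const card_ord mulr_natl.
  apply: ler_sum => i _; rewrite mxE -expr2 -real_normK ?num_real // expr2.
  by rewrite -[leRHS]mulr1 ler_pM // (le_trans (wt i)).
have := oracle_pythagoras A_unit S_small (noise w t); rewrite -/(energy A S w t).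
set q := dot (_ - _) _ => pyth.
have q0 : 0 <= q by exact: dot_ge0.
apply: recovered_of_events.
  have [S0|S0] := posnP #|S|.
    rewrite S0 mulr0 mul0r /energy.
    have -> : oracle A S (noise w t) = 0.
      apply/matrixP => i j; rewrite ord1 [RHS]mxE oracle_supported //.
      by move/eqP: S0; rewrite cards_eq0 => /eqP ->; rewrite inE.
    by rewrite mulmx0 -(scale0r (0 : 'cV[R]_n)) dotZl mul0r.
  apply: (@le_trans _ _ (2 * sigma ^+ 2)); first by lra.
  have S1 : 1 <= #|S|%:R :> R by rewrite ler1n.
  have := sqr_ge0 sigma; nra.
move=> i iS; rewrite -residualE //.
have g2 : 0 <= gamma / 2 by rewrite divr_ge0 // ltW.
rewrite -ler_sqr ?nnegrE // real_normK ?num_real //.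
apply: le_trans (CauchySchwarz_dot _ _) _; rewrite A_unit mul1r -/q.
have : 0 <= energy A S w t by exact: dot_ge0.
lra.
Qed.

(** The union bound is taken inside the event that the energy is small, where by
[residual_tail] each bad event keeps its factor; this gives a product of probabilities
rather than a sum of failure probabilities. *)
Lemma recovered_ge :
  0 <= 1 - (m%:R - #|S|%:R) * expR (- (gamma ^+ 2 / (8 * sigma ^+ 2))) ->
  (1 - (m%:R - #|S|%:R) * expR (- (gamma ^+ 2 / (8 * sigma ^+ 2)))) *
  (1 - (expR (- 2^-1) * Num.sqrt 2) ^+ #|S|) <= fine (P recovered).
Proof.
set e := expR _; set K := _ * Num.sqrt 2; set p1 := 1 - _ * e => p10.
pose E2 : set T := [set t | energy A S w t <= 2 * #|S|%:R * sigma ^+ 2].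
pose bad i : set T := [set t | gamma / 2 < `|dot (residual A S i) (noise w t)|] `&` E2.
have mE2 : measurable E2.
  rewrite -[X in measurable X]setTI.
  by apply: (measurable_fun_ler (measurable_energy _ _ ww) (measurable_cst _) measurableT
    (Y := [set true])).
have mbad i : measurable (bad i).
  apply: measurableI => //; rewrite -[X in measurable X]setTI.
  have mf : measurable_fun setT (fun t => `|dot (residual A S i) (noise w t)|).
    by apply: measurableT_comp => //; exact: measurable_dot_noise ww _.
  by apply: (measurable_fun_ltr (measurable_cst _) mf measurableT (Y := [set true])).
have mrec := measurable_recovered.
have mU : measurable (\big[setU/set0]_(i | i \notin S) bad i).
  by apply: bigsetU_measurable.
have sub : E2 `<=` recovered `|` \big[setU/set0]_(i | i \notin S) bad i.
  move=> t E2t; have [h|/existsNP[i /not_implyP[iS /negP]]] :=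
    pselect (forall i, i \notin S -> `|dot (residual A S i) (noise w t)| <= gamma / 2).
    by left; exact: recovered_of_events.
  by rewrite -ltNge => h; right; rewrite (bigD1 i) //=; left.
have g2 : 0 <= gamma / 2 by rewrite divr_ge0 // ltW.
have PE2fin : P E2 \is a fin_num by exact: fin_num_measure.
have PE2 : (P E2 <= P recovered + ((m%:R - #|S|%:R) * e)%:E * P E2)%E.
  apply: (@le_trans _ _ (P (recovered `|` \big[setU/set0]_(i | i \notin S) bad i))).
    by apply: le_measure; rewrite ?inE //; exact: measurableU.
  apply: le_trans (measureU2 _ mrec mU) _; apply: leeD => //.
  apply: le_trans (union_bound _ _ _ mbad) _.
  apply: (@le_trans _ _ (\sum_(i | i \notin S) (e%:E * P E2))%E).
    apply: lee_sum => i iS.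
    have := residual_tail A_unit S_small sigma_gt0 ww i (2 * #|S|%:R * sigma ^+ 2) g2.
    congr (_ <= _%:E * _)%E; congr expR; field.
    by rewrite gt_eqF.
  rewrite -(fineK PE2fin) -EFinM sumEFin lee_fin.
  rewrite (eq_bigl (mem (~: S)%SET)) => [|i]; last by rewrite !inE.
  have -> : m%:R - #|S|%:R = #|(~: S)%SET|%:R :> R.
    by rewrite -{1}(card_ord m) -(cardsC S) natrD addrAC subrr add0r.
  by rewrite sumr_const -mulrA mulr_natl.
have Prfin : P recovered \is a fin_num by exact: fin_num_measure.
move: PE2; rewrite -{1 2}(fineK PE2fin) -(fineK Prfin) -EFinM -EFinD lee_fin => PE2.
have PE2c : 1 - K ^+ #|S| <= fine (P E2).
  have := energy_tail A_unit S_small sigma_gt0 ww; rewrite -/K.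
  have -> : [set t | 2 * #|S|%:R * sigma ^+ 2 < energy A S w t] = ~` E2.
    by apply/seteqP; split => t /=; rewrite ltNge => /negP.
  rewrite probability_setC // -(fineK PE2fin) -EFinB lee_fin; lra.
have := ler_wpM2l p10 PE2c; rewrite /p1 in p10 *; lra.
Qed.

End main.

Theorem theorem3 (R : realType) (n m s : nat) (A : 'M[R]_(n, m))
    (x0 : 'cV[R]_m) (sigma gamma : R)
    (d : measure_display) (T : measurableType d) (P : probability T R)
    (w : 'I_n -> {RV P >-> R})
    (nm : (n < m)%N)
    (A_unit : forall i : 'I_m, l2norm (col i A) = 1)
    (x0_s : l0norm x0 = s)
    (sigma_gt0 : 0 < sigma)
    (w_gauss : white_gaussian sigma w)
    (gamma_gt0 : 0 < gamma)
    (s_small : s%:R < 1 / (3 * coherence A)) :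
  let good := [set t : T |
    let b := A *m x0 + \col_(i < n) w i t in
    exists2 xBP : 'cV[R]_m,
      unique (bpdn_solution A b gamma) xBP &
      l2norm (x0 - xBP) ^+ 2 <=
        (sigma * Num.sqrt 3 + 3 / 2 * gamma) ^+ 2 * s%:R] in
  measurable good /\
  (((1 - (m%:R - s%:R) * expR (- (gamma ^+ 2 / (8 * sigma ^+ 2)))) *
    (1 - expR (- (s%:R / 7))))%:E < P good)%E.
Proof.
move=> good.
have A1 i : dot (col i A) (col i A) = 1 by rewrite -l2norm_sqr A_unit expr1n.
have mu0 := coherence_ge0 A.
have mu_gt0 : 0 < coherence A.
  rewrite lt_neqAle mu0 andbT eq_sym; apply/eqP => mu_eq0.
  by move: s_small; rewrite mu_eq0 mulr0 invr0 mulr0 ltrn0.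
have small : 3 * (s%:R * coherence A) < 1.
  by move: s_small; rewrite ltr_pdivlMr ?mulr_gt0 // mulrCA.
have ww := white_gaussian_white w_gauss.
rewrite -x0_s in small good *.
have -> : good = recovered A x0 sigma gamma (fun i => w i) by [].
split; first exact: measurable_recovered gamma_gt0 ww.
rewrite -/(l0norm x0).
have rec0 := recovered_gt0 A1 small sigma_gt0 gamma_gt0 ww.
have Prfin : P (recovered A x0 sigma gamma (fun i => w i)) \is a fin_num.
  by apply: fin_num_measure; exact: measurable_recovered gamma_gt0 ww.
have le1 : 0 <= 1 - expR (- ((l0norm x0)%:R / 7)) :> R.
  by rewrite subr_ge0 expR_le1 oppr_le0 divr_ge0.
have [neg|pos] := leP ((1 - (m%:R - (l0norm x0)%:R) * expR (- (gamma ^+ 2 / (8 * sigma ^+ 2)))) *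
    (1 - expR (- ((l0norm x0)%:R / 7)))) 0.
  by apply: le_lt_trans rec0; rewrite lee_fin.
(* from here on the claimed bound is positive, which forces the support to be nonempty *)
have p2 : 0 < 1 - expR (- ((l0norm x0)%:R / 7)) :> R.
  by rewrite lt_def le1 andbT; apply: contraTneq pos => ->; rewrite mulr0 ltxx.
have p1 := pos; rewrite pmulr_lgt0 // in p1.
have s_gt0 : (0 < l0norm x0)%N.
  by rewrite lt0n; apply: contraTneq p2 => ->; rewrite mul0r oppr0 expR0 subrr ltxx.
have ge := recovered_ge A1 small sigma_gt0 gamma_gt0 ww (ltW p1).
rewrite -(fineK Prfin) lte_fin; apply: lt_le_trans ge.
rewrite ltr_pM2l // ltrD2l ltrN2.
have -> : - ((l0norm x0)%:R / 7) = (l0norm x0)%:R * - 7^-1 :> R by field.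
rewrite expRM_natl ltr_pXn2r // ?nnegrE ?mulr_ge0 ?expR_ge0 //.
exact: chi_square_constant.
Qed.
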